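(* Let $Q\subset\mathbb{R}^2$ be a centrally symmetric convex polygon, identified with $Q\times\{0\}\subset\mathbb{R}^3$. Let $P\subset\mathbb{R}^3$ be a convex polytope such that $\partial Q\times[0,\epsilon]\subset\partial P$ for some $\epsilon>0$, $P$ is combinatorially equivalent to a prism over $Q$, and the facet $Q'\subset P$ opposite to $Q$ is not parallel to $Q$; i.e., $P$ is a slant-truncated right prism over $Q$. Let $f:P\to Q$ be the orthogonal projection. Then $$\#\mathrm{vert}\big(\Sigma\,\mathrm{Hom}(Q,f)\big)\ \ge\ \#\mathrm{vert}\big(\mathrm{Hom}(Q,\Sigma f)\big)+2.$$ In particular, $\Sigma\,\mathrm{Hom}(Q,f)\not\cong\mathrm{Hom}(Q,\Sigma f)$, where $\cong$ denotes isomorphism by an affine bijection.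
   Context: All vector spaces are finite-dimensional and real; polytopes are convex; affine maps are maps respecting barycentric coordinates. $\mathrm{vert}(R)$ is the set of vertices of a polytope $R$, and $\partial$ denotes relative boundary. For compact convex sets $A,B$ (in vector spaces), $\mathrm{Hom}(A,B)$ is the set of affine maps $A\to B$, viewed as a compact convex subset of the affine space of affine maps $\mathrm{Aff}(A)\to\mathrm{Aff}(B)$, where $\mathrm{Aff}$ denotes affine hull; it is a polytope if $A$ and $B$ are polytopes. For an affine map $f:A\to B$ and a compact convex set $Z$, $\mathrm{Hom}(Z,f):\mathrm{Hom}(Z,A)\to\mathrm{Hom}(Z,B)$ is the affine map $\phi\mapsto f\circ\phi$. Fiber: let $g:X\to Y$ be an affine map of compact convex sets (not necessarily surjective), $X\subset V$ with $V$ a vector space, with translation invariant Borel measures chosen on $\mathrm{Aff}(X)$ and $\mathrm{Aff}(g(X))$. Put $\Gamma_g=\{\gamma:g(X)\to X \mid \gamma \text{ Borel measurable},\ g\circ\gamma=\mathbf{1}_{g(X)}\}$. Then $$\Sigma g=\frac{1}{\mathrm{vol}(g(X))}\Big\{\int_{g(X)}\gamma(y)\,dy\ \Big|\ \gamma\in\Gamma_g\Big\}\subset V.$$ It is a compact convex set, and a polytope if $X$ and $Y$ are polytopes. *)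

(* Defs.v *)
From mathcomp Require Import all_boot all_order all_algebra.
From mathcomp Require Import all_classical all_reals all_analysis.

Set Implicit Arguments.
Unset Strict Implicit.
Unset Printing Implicit Defensive.

Import Order.TTheory GRing.Theory Num.Theory.
Import numFieldNormedType.Exports.

Local Open Scope classical_set_scope.
Local Open Scope ring_scope.

Section Convex.
Context {R : realType} {V : lmodType R}.
Implicit Types A K F : set V.

Definition aff_hull A : set V :=
  [set x | exists n (a : 'I_n -> V) (c : 'I_n -> R),
    [/\ forall i, A (a i), \sum_i c i = 1 & x = \sum_i c i *: a i]].

Definition conv_hull A : set V :=
  [set x | exists n (a : 'I_n -> V) (c : 'I_n -> R),
    [/\ forall i, A (a i), forall i, 0 <= c i, \sum_i c i = 1
      & x = \sum_i c i *: a i]].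

Definition polytope K := exists s : seq V, K = conv_hull [set` s].

(* The empty face and K itself are included (take l = 0). *)
Definition face K F := exists (l : {scalar V}) (c : R),
  (forall x, K x -> l x <= c) /\ F = K `&` [set x | l x = c].

Definition vert K : set V := [set x | face K [set x]].

Definition centrally_symmetric K :=
  exists c : V, forall x, K x -> K (c *+ 2 - x).

Definition parallel A K :=
  exists u : V, aff_hull K = [set x + u | x in aff_hull A].

End Convex.

(* Isomorphism between the face lattices of K and L. *)
Definition face_iso (R : realType) (V W : lmodType R) (K : set V) (L : set W)
    (Phi : set V -> set W) :=
  set_bij (face K) (face L) Phi /\
  forall F G, face K F -> face K G -> (Phi F `<=` Phi G <-> F `<=` G).

Definition affine_on (R : realType) (V W : lmodType R) (K : set V)
    (psi : V -> W) :=
  forall (x y : V) (t : R), K x -> K y -> 0 <= t <= 1 ->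
    psi ((1 - t) *: x + t *: y) = (1 - t) *: psi x + t *: psi y.

Definition aff_isomorphic (R : realType) (V W : lmodType R)
    (K : set V) (L : set W) :=
  exists psi : V -> W, affine_on K psi /\ set_bij K L psi.

(* Takes the value +oo when K has infinitely many vertices. *)
Definition nvert (R : realType) (V : lmodType R) (K : set V) : \bar R :=
  @counting V R (vert K).

Definition rel_interior (R : realType) (V : normedModType R) (K : set V)
    : set V :=
  K `&` [set x | \forall y \near x, aff_hull K y -> K y].

Definition rel_boundary (R : realType) (V : normedModType R) (K : set V)
    : set V :=
  closure K `\` rel_interior K.

Notation borel T := (g_sigma_algebraType (@open T)).

(* A translation invariant Borel measure on the affine space A, regarded as a
   Borel measure on the ambient space that is concentrated on A; it is nonzero
   and finite on compact sets, hence unique up to a positive factor. *)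
Definition translation_invariant (R : realType) (p q : nat)
    (A : set 'M[R]_(p, q)) (mu : {measure set (borel 'M[R]_(p, q)) -> \bar R}) :=
  [/\ mu (~` A) = 0%E,
      (0 < mu A)%E,
      forall C : set 'M[R]_(p, q), compact C -> (mu C < +oo)%E &
      forall (a b : 'M[R]_(p, q)) (B : set (borel 'M[R]_(p, q))),
        A a -> A b -> measurable B -> mu [set x + (a - b) | x in B] = mu B].

Section Fiber.
Context {R : realType} {p q r s : nat}.
Local Notation V := 'M[R]_(p, q).
Local Notation W := 'M[R]_(r, s).

Definition borel_sections (g : V -> W) (X : set V) : set (borel W -> borel V) :=
  [set gam : borel W -> borel V | [/\ measurable_fun (g @` X : set (borel W)) gam,
                 gam @` (g @` X) `<=` X &
                 forall y, (g @` X) y -> g (gam y) = y]].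

Definition mx_integral (mu : {measure set (borel W) -> \bar R}) (D : set W)
    (gam : borel W -> borel V) : V :=
  \matrix_(i, j) \int[mu]_(y in D) (gam y : V) i j.

(* The fiber of g : X -> Y, computed with the measure mu on Aff(g(X)); it does
   not depend on Y, nor on the normalization of mu. *)
Definition fiber (mu : {measure set (borel W) -> \bar R})
    (g : V -> W) (X : set V) : set V :=
  [set (fine (mu (g @` X)))^-1 *: mx_integral mu (g @` X) gam
     | gam in borel_sections g X].

End Fiber.

Section Hom.
Context {R : realType}.

(* The vector space of affine maps R^n -> R^m is identified with that of
   (1 + n) x m matrices: row 0 is the image of the origin, the other rows form
   the matrix of the linear part. *)
Definition aff_of (n m : nat) (M : 'M[R]_(1 + n, m)) (x : 'rV[R]_n)
    : 'rV[R]_m :=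
  row_mx 1%:M x *m M.

Definition mx_of_aff (n m : nat) (phi : 'rV[R]_n -> 'rV[R]_m)
    : 'M[R]_(1 + n, m) :=
  col_mx (phi 0) (\matrix_(i < n) (phi (delta_mx 0 i) - phi 0)).

Lemma aff_ofK n m : cancel (@aff_of n m) (@mx_of_aff n m).
Proof.
move=> M; rewrite -[M]vsubmxK /mx_of_aff /aff_of !mul_row_col mul1mx mul0mx.
rewrite addr0; congr col_mx; apply/row_matrixP => i.
by rewrite rowK mul_row_col mul1mx addrC addKr rowE.
Qed.

Lemma mx_of_affK n m (L : 'M[R]_(n, m)) (b : 'rV[R]_m) :
  aff_of (mx_of_aff (fun x => b + x *m L)) = (fun x => b + x *m L).
Proof.
apply/funext => x; rewrite /aff_of /mx_of_aff mul_row_col mul1mx mul0mx addr0.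
congr (_ + x *m _); apply/row_matrixP => i.
by rewrite rowK addrC addKr rowE.
Qed.

(* Only meant for sets A whose affine hull is the whole of R^n: then affine
   maps Aff(A) -> Aff(B) with f(A) in B are the affine maps R^n -> R^m with
   f(A) in B. *)
Definition Hom_set (n m : nat) (A : set 'rV[R]_n) (B : set 'rV[R]_m)
    : set 'M[R]_(1 + n, m) :=
  [set M | aff_of M @` A `<=` B].

(* The map Hom(Z, f) : phi |-> f \o phi, for f affine. *)
Definition Hom_map (n m k : nat) (f : 'rV[R]_m -> 'rV[R]_k)
    (M : 'M[R]_(1 + n, m)) : 'M[R]_(1 + n, k) :=
  mx_of_aff (f \o aff_of M).

(* A * T in R^2 * R = R^3. *)
Definition cyl (A : set 'rV[R]_2) (T : set R) : set 'rV[R]_(2 + 1) :=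
  [set row_mx x t%:M | x in A & t in T].

Definition proj_base (x : 'rV[R]_(2 + 1)) : 'rV[R]_2 := lsubmx x.

End Hom.

(* Main.v *)
From HB Require Import structures.
Require Import Defs.
From mathcomp Require Import all_boot all_order all_algebra.
From mathcomp Require Import all_classical all_reals all_analysis.
From mathcomp Require Import measurable_realfun zify ring lra.

Set Implicit Arguments.
Unset Strict Implicit.
Unset Printing Implicit Defensive.

Import Order.TTheory GRing.Theory Num.Theory.
Import numFieldNormedType.Exports.

Local Open Scope classical_set_scope.
Local Open Scope ring_scope.

(** Let [c] be the centre of [Q]. The hypotheses give an affine function
[eta], positive on [Q] and not constant, such that [P] is the set of points at height
between [0] and [eta] above [Q]; see [truncated_prism]. The projection forgets the
height, so both fibers are sets of means of affine functions.

The fiber of [P] over [Q] is a vertical segment, see [fiber_baseE], of length [H], say.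
Hence [Hom] from [Q] to this fiber is affinely the set of the affine functions on [Q]
with values in [[0, 1]]. By the symmetry of [Q], it is a bipyramid: its apexes are the
constants [0] and [1], and its other extreme points are the edge functions, which vanish
on one edge of [Q] and are equal to [1] on the opposite one; see [extreme_unit_fun].
Writing [e] for the number of edge functions, there are at most [e + 2] extreme points.

An element of [Hom(Q, P)] is a pair of an affine map [alpha] from [Q] to [Q] and an affine
function [u] with [0 <= u <= eta \o alpha] on [Q]. So the second fiber consists of the
means, over [alpha] in [Hom(Q, Q)], of measurable choices of such functions [u]. It has
the apexes [0] and the mean [G] of [eta \o alpha]. For an edge function [s], let
[slope s] be the largest [t] with [t * s <= eta \o alpha]. The mean of [slope s * s]
is again a vertex, by [vert_slope]: among all admissible [u], the function
[slope s * s] has the largest value at a point where [s] is [1], up to an error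
controlled by the values of [u] at two points where [s] vanishes, uniformly in [alpha].
The reflection [u |-> eta \o alpha - u] yields the vertex [G - slope s * s] in the mean.

In a bipyramid these two families of vertices would be the same one. Here they are
disjoint: [s] is equal to [1] at two points at least, and as [eta] is not constant,
[eta \o alpha] takes a smaller value at one of them than at a given point [x] for [alpha] in
some open set; for these [alpha] the function [slope s * s] is strictly below
[eta \o alpha] at [x]. Thus the mean of [slope s * s] is strictly below [G] everywhere, see
[slope_lt_roof], while a reflected vertex meets [G] on an edge. So the second fiber has at
least [2 * e + 2] vertices, and [2 * e + 2 >= (e + 2) + 2] because [e >= 2].

About the measures, the argument takes that compact sets have finite measure, and that
nonempty open sets have positive measure, by [translation_invariant_gt0]. The same count
of extreme points excludes an affine isomorphism, see [extreme_image]; this uses the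
convexity of the fiber. *)

(** * Convex sets, faces and extreme points *)

Section ConvexSets.
Context {R : realType} {V : lmodType R}.
Implicit Types A K F : set V.

Definition convex K := forall (x y : V) (t : R),
  K x -> K y -> 0 <= t <= 1 -> K ((1 - t) *: x + t *: y).

Lemma convex_sum K : convex K -> forall n (a : 'I_n -> V) (c : 'I_n -> R),
  (forall i, K (a i)) -> (forall i, 0 <= c i) -> \sum_i c i = 1 ->
  K (\sum_i c i *: a i).
Proof.
move=> cK; elim=> [|n IHn] a c Ka c0.
  by rewrite big_ord0 => /esym/eqP; rewrite oner_eq0.
rewrite !big_ord_recr /=; set S := \sum_(i < n) c _; move=> S1.
have cE : c ord_max = 1 - S by move: S1; lra.
have S0 : 0 <= S by exact: sumr_ge0.
have [S00|Sn0] := eqVneq S 0.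
  rewrite cE S00 subr0 scale1r big1 ?add0r // => i _.
  have /eqP := S00; rewrite psumr_eq0 // => /allP/(_ i).
  by rewrite mem_index_enum => /(_ isT)/eqP ->; rewrite scale0r.
rewrite (_ : \sum_(i < n) _ =
    S *: \sum_(i < n) (c (widen_ord (leqnSn n) i) / S)
           *: a (widen_ord (leqnSn n) i)); last first.
  rewrite scaler_sumr; apply: eq_bigr => i _.
  by rewrite scalerA mulrCA divff // mulr1.
set X := \sum_(i < n) _ *: _.
have -> : S *: X = (1 - (1 - S)) *: X by congr (_ *: _); ring.
rewrite cE; apply: cK => //; last by rewrite subr_ge0 -{1}S1 lerDl c0 lerBlDr lerDl.
by apply: IHn => // [i|]; [exact: divr_ge0|rewrite -mulr_suml divff].
Qed.

Lemma convex_conv_hull A : convex (conv_hull A).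
Proof.
move=> x y t [n [a [c [Aa c0 c1 ->]]]] [m [b [d [Ab d0 d1 ->]]]] /andP[t0 t1].
exists (n + m)%N, (fun i => match fintype.split i with inl i => a i | inr i => b i end).
exists (fun i => match fintype.split i with
   | inl i => (1 - t) * c i | inr i => t * d i end); split.
- by move=> i; case: fintype.split.
- by move=> i; case: fintype.split => j; apply: mulr_ge0 => //; rewrite subr_ge0.
- rewrite big_split_ord /=.
  under eq_bigr do rewrite (unsplitK (inl _)).
  under [X in _ + X]eq_bigr do rewrite (unsplitK (inr _)).
  by rewrite -!mulr_sumr c1 d1 !mulr1 subrK.
- rewrite big_split_ord /=; congr (_ + _); rewrite scaler_sumr.
    by apply: eq_bigr => i _; rewrite (unsplitK (inl _)) scalerA.
  by apply: eq_bigr => i _; rewrite (unsplitK (inr _)) scalerA.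
Qed.

Lemma sub_conv_hull A : A `<=` conv_hull A.
Proof.
move=> x Ax; exists 1%N, (fun=> x), (fun=> 1).
by split => //; rewrite big_ord1 ?scale1r.
Qed.

Lemma conv_hull_min A K : convex K -> A `<=` K -> conv_hull A `<=` K.
Proof. by move=> cK AK x [n [a [c [Aa c0 c1 ->]]]]; apply: convex_sum => // i; exact: AK. Qed.

Lemma conv_hull_sub A K : A `<=` conv_hull K -> conv_hull A `<=` conv_hull K.
Proof. by move=> AK; apply: conv_hull_min => //; exact: convex_conv_hull. Qed.

Lemma sub_aff_hull A : A `<=` aff_hull A.
Proof.
move=> x Ax; exists 1%N, (fun=> x), (fun=> 1).
by split => //; rewrite big_ord1 ?scale1r.
Qed.

Lemma face_sub K F : face K F -> F `<=` K.
Proof. by move=> [l [c [_ ->]]] x []. Qed.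

Lemma vert_sub K : vert K `<=` K.
Proof. by move=> x /face_sub; exact. Qed.

(** A function proved linear becomes an object of type [{scalar V}], as the definition
of faces requires. *)
Lemma scalar_of (f : V -> R) : (forall (a : R) u v, f (a *: u + v) = a * f u + f v) ->
  exists l : {scalar V}, l =1 f.
Proof.
move=> fl.
pose P := GRing.isLinear.Build R V R *%R f fl.
pose l : {scalar V} := HB.pack f P.
by exists l.
Qed.

(** The sum of the two supporting functionals attains its maximum exactly where both do. *)
Lemma faceI K F G : face K F -> face K G -> face K (F `&` G).
Proof.
move=> [l [c [lc ->]]] [m [d [md ->]]].
have [k kE] : exists k : {scalar V}, k =1 (fun x => l x + m x).
  by apply: scalar_of => a u v; rewrite !linearP /=; ring.
exists k, (c + d); split; first by move=> x Kx; rewrite kE lerD // (lc, md).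
apply/seteqP; split => x /=; rewrite kE.
  by move=> [[Kx ->] [_ ->]].
move=> [Kx E]; have := lc _ Kx; have := md _ Kx => ? ?.
by split; split => //; lra.
Qed.

Lemma face0 K : face K set0.
Proof.
have [k kE] : exists k : {scalar V}, k =1 (fun x => 0).
  by apply: scalar_of => a u v; ring.
exists k, 1; split => [x _|]; first by rewrite kE ler01.
by apply/seteqP; split => // x [_ /=]; rewrite kE => /esym/eqP; rewrite oner_eq0.
Qed.

(** Only vertices, that is exposed points, are counted in the end, but it is extremality
that an affine bijection visibly preserves. Testing midpoints is enough here. *)
Definition extreme K x := K x /\ forall y z, K y -> K z ->
  x = 2^-1 *: y + 2^-1 *: z -> y = x.

Lemma vert_extreme K : vert K `<=` extreme K.
Proof.
move=> x Vx; split; first exact: vert_sub.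
move: Vx => [l [c [lc E]]] y z Ky Kz xE.
have lx : l x = c by have : [set x] x by []; rewrite E => -[].
suff : [set x] y by [].
rewrite E; split => //=; move: lx (lc _ Ky) (lc _ Kz); rewrite xE.
by rewrite linearP linearZ /=; lra.
Qed.

(** A weighted mean of numbers that are at most [b] equals [b] only if all the numbers
with nonzero weight do. *)
Lemma face_conv_comb (l : {scalar V}) (b : R) n (a : 'I_n -> V) (c : 'I_n -> R) :
  (forall i, l (a i) <= b) -> (forall i, 0 <= c i) -> \sum_i c i = 1 ->
  l (\sum_i c i *: a i) = b -> forall i, c i != 0 -> l (a i) = b.
Proof.
move=> lb c0 c1 lE i ci.
have : \sum_i c i * (b - l (a i)) = 0.
  under eq_bigr do rewrite mulrBr.
  rewrite sumrB -mulr_suml c1 mul1r -lE linear_sum /=.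
  by apply/eqP; rewrite subr_eq0; apply/eqP/eq_bigr => j _; rewrite linearZ.
move/eqP; rewrite psumr_eq0; last by move=> j _; rewrite mulr_ge0 // subr_ge0.
move/allP/(_ i); rewrite mem_index_enum => /(_ isT).
by rewrite mulf_eq0 (negPf ci) /= subr_eq0 => /eqP.
Qed.

(** Grouping the terms of a convex combination by their point makes the standard simplex
on the list [s] a sufficient parameter space, which gives compactness. *)
Lemma conv_hull_seqP (s : seq V) x : conv_hull [set` s] x <->
  exists c : 'I_(size s) -> R, [/\ forall i, 0 <= c i, \sum_i c i = 1 &
    x = \sum_i c i *: tnth (in_tuple s) i].
Proof.
split=> [[n [a [c [Aa c0 c1 ->]]]]|[c [c0 c1 ->]]]; last first.
  exists (size s), (tnth (in_tuple s)), c; split => // i /=; exact: mem_tnth.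
have idx i : (index (a i) s < size s)%N by rewrite index_mem; exact: Aa.
pose f i := Ordinal (idx i).
exists (fun k => \sum_(i | f i == k) c i); split.
- by move=> k; apply: sumr_ge0.
- by rewrite -c1 [RHS](partition_big f xpredT).
- rewrite [LHS](partition_big f xpredT) //=; apply: eq_bigr => k _.
  rewrite scaler_suml; apply: eq_bigr => i /eqP <-.
  by rewrite (tnth_nth (a i)) /= nth_index //; exact: Aa.
Qed.

End ConvexSets.

(** * Topology of spaces of matrices *)

Section MatrixTopology.
Context {R : realType}.

Section RealContinuity.
Context {T : topologicalType}.
Implicit Types f g : T -> R.

Lemma cst_cont (k : R) : continuous (fun _ : T => k).
Proof. by move=> x; exact: cvg_cst. Qed.

Lemma mul_cont f g : continuous f -> continuous g -> continuous (fun x => f x * g x).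
Proof. by move=> cf cg x; exact: continuousM (cf x) (cg x). Qed.

Lemma add_cont f g : continuous f -> continuous g -> continuous (fun x => f x + g x).
Proof. by move=> cf cg x; exact: continuousD (cf x) (cg x). Qed.

Lemma sub_cont f g : continuous f -> continuous g -> continuous (fun x => f x - g x).
Proof. by move=> cf cg x; exact: continuousB (cf x) (cg x). Qed.

Lemma min_cont f g : continuous f -> continuous g ->
  continuous (fun x => Num.min (f x) (g x)).
Proof. by move=> cf cg x; exact: continuous_min (cf x) (cg x). Qed.

End RealContinuity.

Lemma mx_ballP p q (M N : 'M[R]_(p, q)) e : 0 < e ->
  (ball M e N <-> forall i j, `|M i j - N i j| < e).
Proof.
by move=> e0; split=> [[_ h]|h]; [move=> i j; exact: h|split => // i j; exact: h].
Qed.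

Lemma mx_continuous (T : topologicalType) p q (f : T -> 'M[R]_(p, q)) :
  (forall i j, continuous (fun x => f x i j)) -> continuous f.
Proof.
move=> fc x A /nbhs_ballP[e /= e0 eA]; rewrite nbhs_filterE.
have : \forall y \near x, forall i j, ball (f x i j) e (f y i j).
  by do 2!apply: filter_forall => ?; apply: fc; exact: nbhsx_ballx.
by apply: filterS => y fy; apply: eA; split.
Qed.

Lemma sum_continuous (T : topologicalType) (I : Type) (s : seq I) (P : pred I)
    (f : I -> T -> R) : (forall i, continuous (f i)) ->
  continuous (fun x => \sum_(i <- s | P i) f i x).
Proof.
move=> fc; elim: s => [|i s IHs] x.
  under eq_fun do rewrite big_nil; exact: cvg_cst.
under eq_fun do rewrite big_cons; case: (P i); last exact: IHs.
by apply: continuousD; [exact: fc|exact: IHs].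
Qed.

Lemma scalar_mxE p q (l : {scalar 'M[R]_(p, q)}) M :
  l M = \sum_i \sum_j M i j * l (delta_mx i j).
Proof.
rewrite {1}[M]matrix_sum_delta linear_sum; apply: eq_bigr => i _.
by rewrite linear_sum; apply: eq_bigr => j _; rewrite linearZ.
Qed.

Lemma scalar_continuous p q (l : {scalar 'M[R]_(p, q)}) : continuous l.
Proof.
rewrite (_ : (l : 'M[R]_(p, q) -> R) =
  fun M => \sum_i \sum_j M i j * l (delta_mx i j)); last first.
  by apply/funext => M; exact: scalar_mxE.
do 2!apply: sum_continuous => ?.
by apply: mul_cont; [exact: coord_continuous|exact: cst_cont].
Qed.

Lemma linear_mx_continuous p q r s (f : {linear 'M[R]_(p, q) -> 'M[R]_(r, s)}) :
  continuous f.
Proof.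
apply: mx_continuous => i j.
have [l lE] : exists l : {scalar 'M[R]_(p, q)}, l =1 fun x => f x i j.
  by apply: (@scalar_of _ _ (fun x : 'M[R]_(p, q) => f x i j)) => a u v; rewrite linearP !mxE.
by rewrite (_ : (fun x => f x i j) = l); [exact: scalar_continuous|exact/funext].
Qed.

Lemma box_compact p q (B : R) :
  compact [set M : 'M[R]_(p, q) | forall i j, `|M i j| <= B].
Proof.
have cK : compact [set v : 'rV[R]_(p * q) | forall i, `[- B, B]%classic (v 0 i)].
  by apply: (@rV_compact R (p * q) (fun=> `[- B, B]%classic)) => i; exact: segment_compact.
have vec_mxC := @linear_mx_continuous _ _ _ _ (@vec_mx R p q).
have := continuous_compact (continuous_subspaceT vec_mxC) cK.
congr compact; apply/seteqP; split => [_ [v vB <-] i j|M MB /=].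
  by rewrite mxE ler_norml; have := vB (mxvec_index i j); rewrite /= in_itv.
exists (mxvec M); last exact: mxvecK.
move=> k; case/mxvec_indexP: k => i j.
by rewrite mxvecE /= in_itv /= -ler_norml.
Qed.

Lemma conv_hull_seq_compact p q (s : seq 'M[R]_(p, q)) : compact (conv_hull [set` s]).
Proof.
pose simplex := [set v : 'rV[R]_(size s) | forall i, `[0, 1]%classic (v 0 i)] `&`
  [set v : 'rV[R]_(size s) | \sum_i v 0 i = 1].
have cS : compact simplex.
  have cc : compact [set v : 'rV[R]_(size s) | forall i, `[0, 1]%classic (v 0 i)].
    by apply: (@rV_compact R (size s) (fun=> `[0, 1]%classic)) => i; exact: segment_compact.
  apply: (subclosed_compact _ cc); last by move=> x [].
  apply: closedI; first exact: (compact_closed (@norm_hausdorff _ _) cc).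
  apply: (@closed_comp _ _ (fun v : 'rV[R]_(size s) => \sum_i v 0 i) [set 1]).
    by move=> x _; apply: sum_continuous => i; exact: coord_continuous.
  exact: closed_eq.
pose f (v : 'rV[R]_(size s)) := \sum_i v 0 i *: tnth (in_tuple s) i.
have cf : continuous f.
  apply: mx_continuous => i j; under eq_fun do rewrite summxE.
  apply: sum_continuous => k; under eq_fun do rewrite mxE.
  by apply: mul_cont; [exact: coord_continuous|exact: cst_cont].
have := continuous_compact (continuous_subspaceT cf) cS.
congr compact; apply/seteqP; split => [_ [v [v0 v1] <-]|x].
  apply/conv_hull_seqP; exists (v 0); split => // i.
  by have := v0 i; rewrite /= in_itv /= => /andP[].
move/conv_hull_seqP => [c [c0 c1 ->]]; exists (\row_i c i); last first.
  by apply: eq_bigr => i _; rewrite mxE.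
split=> [i|/=]; last by under eq_bigr do rewrite mxE.
rewrite mxE /= in_itv /= c0 /= -c1 (bigD1 i) //= lerDl; exact: sumr_ge0.
Qed.

Lemma polytope_compact p q (K : set 'M[R]_(p, q)) : polytope K -> compact K.
Proof. by move=> [s ->]; exact: conv_hull_seq_compact. Qed.

Lemma polytope_convex (V : lmodType R) (K : set V) : polytope K -> convex K.
Proof. by move=> [s ->]; exact: convex_conv_hull. Qed.

Lemma compact_mx_closed p q (K : set 'M[R]_(p, q)) : compact K -> closed K.
Proof. by apply: compact_closed; exact: norm_hausdorff. Qed.

Lemma compact_mx_bounded p q (K : set 'M[R]_(p, q)) : compact K ->
  exists B, forall M, K M -> forall i j, `|M i j| <= B.
Proof.
move=> /compact_bounded [B [_ h]]; exists (B + 1) => M KM i j.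
have := h (B + 1); rewrite ltrDl ltr01 => /(_ isT M KM).
by apply: le_trans; rewrite /Num.norm /= mx_normrE (le_bigmax _ (fun i => `|M i.1 i.2|) (i, j)).
Qed.

End MatrixTopology.

(** * Polytopes are generated by their vertices *)

Section Minkowski.
Context {R : realType} {n : nat}.
Implicit Types x y z : 'rV[R]_n.

Definition dot x y := \sum_i x 0 i * y 0 i.

Lemma dotC x y : dot x y = dot y x.
Proof. by apply: eq_bigr => i _; rewrite mulrC. Qed.

Lemma dotDl x y z : dot (x + y) z = dot x z + dot y z.
Proof. by rewrite -big_split; apply: eq_bigr => i _; rewrite mxE mulrDl. Qed.

Lemma dotZl a x z : dot (a *: x) z = a * dot x z.
Proof. by rewrite mulr_sumr; apply: eq_bigr => i _; rewrite mxE mulrA. Qed.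

Lemma dotDr x y z : dot x (y + z) = dot x y + dot x z.
Proof. by rewrite dotC dotDl !(dotC _ x). Qed.

Lemma dotZr a x z : dot x (a *: z) = a * dot x z.
Proof. by rewrite dotC dotZl dotC. Qed.

Lemma dotNl x z : dot (- x) z = - dot x z.
Proof. by rewrite -scaleN1r dotZl mulN1r. Qed.

Lemma dotNr x z : dot x (- z) = - dot x z.
Proof. by rewrite dotC dotNl dotC. Qed.

Definition dotE := (dotDl, dotDr, dotZl, dotZr, dotNl, dotNr).

Lemma dot_ge0 x : 0 <= dot x x.
Proof. by apply: sumr_ge0 => i _; rewrite -expr2 sqr_ge0. Qed.

Lemma dot_eq0 x : dot x x = 0 -> x = 0.
Proof.
move/eqP; rewrite psumr_eq0 => [/allP h|i _]; last by rewrite -expr2 sqr_ge0.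
apply/rowP => i; rewrite mxE; apply/eqP.
by have := h i (mem_index_enum _); rewrite mulf_eq0 orbb.
Qed.

Lemma dot_gt0 x : x != 0 -> 0 < dot x x.
Proof. by rewrite lt_def dot_ge0 andbT; apply: contra_neq; exact: dot_eq0. Qed.

Lemma dot_scalar x : exists l : {scalar 'rV[R]_n}, forall y, l y = dot x y.
Proof. by apply: scalar_of => a u v; rewrite !dotE. Qed.

Lemma dot_line x y t : dot (x - t *: y) (x - t *: y) =
  dot x x - 2 * t * dot x y + t ^+ 2 * dot y y.
Proof. by rewrite !dotE (dotC y x); ring. Qed.

(** The nearest point [p] of [K] to [x] gives the separating functional
[dot (x - p)]: moving from [p] towards [y] would otherwise decrease the distance. *)
Lemma separation (K : set 'rV[R]_n) x : compact K -> convex K -> ~ K x ->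
  exists (l : {scalar 'rV[R]_n}) (b : R), (forall y, K y -> l y <= b) /\ b < l x.
Proof.
move=> cK vK nKx; have [[y0 Ky0]|K0] := pselect (K !=set0); last first.
  have [l lE] := dot_scalar 0; exists l, (l x - 1); split; last by rewrite ltrBlDr ltrDl.
  by move=> y Ky; exfalso; apply: K0; exists y.
have cf : continuous (fun y => dot (x - y) (x - y)).
  apply: sum_continuous => i.
  have ci : continuous (fun y : 'rV[R]_n => (x - y) 0 i).
    under eq_fun do rewrite !mxE.
    by apply: sub_cont; [exact: cst_cont|exact: coord_continuous].
  exact: mul_cont.
have [|p Kp pmin] := @compact_EVT_min _ R _ K _ cK (continuous_subspaceT cf).
  by exists y0.
rewrite inE in Kp.
have [l lE] := dot_scalar (x - p).
have px0 : 0 < dot (x - p) (x - p).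
  by apply: dot_gt0; rewrite subr_eq0; apply/eqP => xp; apply: nKx; rewrite xp.
exists l, (l p); split; last by rewrite -subr_gt0 -linearB lE.
move=> y Ky; rewrite -subr_le0 -linearB lE leNgt; apply/negP => d0.
set a := dot _ _ in d0.
pose q := dot (y - p) (y - p).
have q0 : 0 <= q by exact: dot_ge0.
pose t := a / (a + q).
have aq : 0 < a + q by rewrite ltr_wpDr.
have t0 : 0 < t by rewrite divr_gt0.
have t1 : t <= 1 by rewrite ler_pdivrMr // mul1r lerDl.
have := pmin ((1 - t) *: p + t *: y).
rewrite inE => /(_ (vK _ _ _ Kp Ky _)); rewrite t1 (ltW t0) => /(_ isT).
have -> : x - ((1 - t) *: p + t *: y) = (x - p) - t *: (y - p).
  by apply/rowP => i; rewrite !mxE; ring.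
rewrite dot_line -/a -/q.
have tE : t * (a + q) = a by rewrite divfK ?gt_eqF.
have : 0 < t * (2 * a - t * q) by apply: mulr_gt0 => //; move: tE; nra.
lra.
Qed.

(** A generator that is not in the convex hull of the others is strictly separated
from them, hence exposed; so a minimal generating set consists of vertices. *)
Lemma polytope_conv_vert (K : set 'rV[R]_n) : polytope K -> K `<=` conv_hull (vert K).
Proof.
move=> [s]; have [m] := ubnP (size s); elim: m s => // m IHm s sm KE.
pose others x := [seq y <- s | y != x].
have [[x [xs xh]]|irr] := pselect (exists x, x \in s /\ conv_hull [set` others x] x).
  apply: (IHm (others x)).
    rewrite -ltnS (leq_trans _ sm) // ltnS size_filter ltn_neqAle count_size andbT.
    by rewrite -all_count; apply/allPn; exists x => //=; rewrite eqxx.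
  rewrite KE; apply/seteqP; split; apply: conv_hull_sub => y /= ys.
    have [->//|yx] := eqVneq y x.
    by apply: sub_conv_hull; rewrite /= mem_filter yx.
  by apply: sub_conv_hull; move: ys; rewrite /= mem_filter => /andP[].
rewrite {1}KE; apply: conv_hull_sub => x /= xs; apply: sub_conv_hull.
have [l [b [lb bx]]] : exists (l : {scalar 'rV[R]_n}) (b : R),
    (forall y, conv_hull [set` others x] y -> l y <= b) /\ b < l x.
  apply: separation; first exact: conv_hull_seq_compact.
    exact: convex_conv_hull.
  by move=> xh; apply: irr; exists x.
have lle y : y \in s -> l y <= l x.
  move=> ys; have [->//|yx] := eqVneq y x.
  apply: (le_trans _ (ltW bx)); apply: lb; apply: sub_conv_hull.
  by rewrite /= mem_filter yx.
have lKle y : K y -> l y <= l x.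
  rewrite KE => -[k [a [c [sa c0 c1 ->]]]]; rewrite linear_sum /=.
  rewrite -[leRHS]mul1r -c1 mulr_suml; apply: ler_sum => i _.
  by rewrite linearZ /= ler_wpM2l // lle //; exact: sa.
exists l, (l x); split => //; apply/seteqP; split => [y ->|y].
  by split => //; rewrite KE; exact: sub_conv_hull.
move=> [Ky /= ly]; move: Ky; rewrite KE => -[k [a [c [sa c0 c1 yE]]]] /=.
have ax i : c i != 0 -> a i = x.
  move=> ci; have lax : l (a i) = l x.
    apply: (face_conv_comb _ c0 c1 _ ci); last by rewrite -yE.
    by move=> j; apply: lle; exact: sa.
  apply/eqP; apply/negP => /negP aix.
  have : l (a i) <= b.
    by apply: lb; apply: sub_conv_hull; rewrite /= mem_filter aix; exact: sa.
  by rewrite lax leNgt bx.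
rewrite yE -[RHS]scale1r -c1 scaler_suml; apply: eq_bigr => i _.
by have [->|/ax ->//] := eqVneq (c i) 0; rewrite !scale0r.
Qed.

End Minkowski.

(** * Affine functions, affine hulls and interior points *)

Section Affine.
Context {R : realType}.

Lemma aff_ofE n m (M : 'M[R]_(1 + n, m)) x : aff_of M x = usubmx M + x *m dsubmx M.
Proof. by rewrite /aff_of -{1}[M]vsubmxK mul_row_col mul1mx. Qed.

Lemma aff_of_comb n m (M : 'M[R]_(1 + n, m)) (a b : R) x y : a + b = 1 ->
  aff_of M (a *: x + b *: y) = a *: aff_of M x + b *: aff_of M y.
Proof.
move=> ab; rewrite !aff_ofE mulmxDl -!scalemxAl !scalerDr.
by rewrite addrACA -scalerDl ab scale1r.
Qed.

Lemma aff_of_sum n m (M : 'M[R]_(1 + n, m)) k (c : 'I_k -> R) (a : 'I_k -> 'rV_n) :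
  \sum_i c i = 1 -> aff_of M (\sum_i c i *: a i) = \sum_i c i *: aff_of M (a i).
Proof.
move=> c1; rewrite aff_ofE mulmx_suml -[usubmx M]scale1r -c1 scaler_suml.
by rewrite -big_split; apply: eq_bigr => i _; rewrite -scalemxAl aff_ofE scalerDr.
Qed.

(** The real affine functions on [R^n]: a column [u] stands for the function whose
value at [x] is [ev u x]. *)
Definition ev n (u : 'cV[R]_(1 + n)) (x : 'rV[R]_n) : R := aff_of u x 0 0.

Lemma ev_comb n (u : 'cV[R]_(1 + n)) (a b : R) x y : a + b = 1 ->
  ev u (a *: x + b *: y) = a * ev u x + b * ev u y.
Proof. by move=> ab; rewrite /ev aff_of_comb // !mxE. Qed.

Lemma ev0 n (x : 'rV[R]_n) : ev 0 x = 0.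
Proof. by rewrite /ev /aff_of mulmx0 mxE. Qed.

Lemma evD n (u v : 'cV[R]_(1 + n)) x : ev (u + v) x = ev u x + ev v x.
Proof. by rewrite /ev /aff_of mulmxDr mxE. Qed.

Lemma evZ n (u : 'cV[R]_(1 + n)) a x : ev (a *: u) x = a * ev u x.
Proof. by rewrite /ev /aff_of -scalemxAr mxE. Qed.

Lemma evN n (u : 'cV[R]_(1 + n)) x : ev (- u) x = - ev u x.
Proof. by rewrite -scaleN1r evZ mulN1r. Qed.

Lemma evB n (u v : 'cV[R]_(1 + n)) x : ev (u - v) x = ev u x - ev v x.
Proof. by rewrite evD evN. Qed.

Lemma ev_exists n (a : R) (l : {scalar 'rV[R]_n}) :
  exists u : 'cV[R]_(1 + n), forall x, ev u x = a + l x.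
Proof.
exists (mx_of_aff (fun x => a%:M + x *m \col_i l (delta_mx 0 i))) => x.
rewrite /ev mx_of_affK !mxE eqxx mulr1n scalar_mxE big_ord1; congr (_ + _).
by apply: eq_bigr => i _; rewrite mxE.
Qed.

Lemma aff_of_inj n m (K : set 'rV[R]_n) (M N : 'M[R]_(1 + n, m)) :
  aff_hull K = setT -> (forall x, K x -> aff_of M x = aff_of N x) -> M = N.
Proof.
move=> KT h; rewrite -[M]aff_ofK -[N]aff_ofK; congr mx_of_aff; apply/funext => x.
have : aff_hull K x by rewrite KT.
move=> [k [a [c [Ka c1 ->]]]]; rewrite !aff_of_sum //.
by apply: eq_bigr => i _; rewrite h.
Qed.

Lemma ev_inj n (K : set 'rV[R]_n) (u v : 'cV[R]_(1 + n)) :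
  aff_hull K = setT -> (forall x, K x -> ev u x = ev v x) -> u = v.
Proof.
move=> KT h; apply: (aff_of_inj KT) => x Kx; apply/rowP => i.
by rewrite ord1; exact: h.
Qed.

Lemma aff_hull_translate (V : lmodType R) (A : set V) u :
  aff_hull [set x + u | x in A] = [set x + u | x in aff_hull A].
Proof.
apply/seteqP; split => [x [k [a [c [Aa c1 ->]]]]|_ [_ [k [a [c [Aa c1 ->]]]] <-]].
  exists (\sum_i c i *: (a i - u)).
    exists k, (fun i => a i - u), c; split => // i.
    by have [y Ay <-] := Aa i; rewrite addrK.
  under eq_bigr do rewrite scalerBr.
  by rewrite sumrB -scaler_suml c1 scale1r subrK.
exists k, (fun i => a i + u), c; split => //; first by move=> i; exists (a i).
under [RHS]eq_bigr do rewrite scalerDr.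
by rewrite big_split -scaler_suml c1 /= scale1r.
Qed.

Lemma ball_aff_hull p q (K : set 'M[R]_(p, q)) a r :
  0 < r -> ball a r `<=` K -> aff_hull K = setT.
Proof.
move=> r0 aK; apply/seteqP; split => // x _.
have [B xB] : exists B, forall i j, `|(x - a) i j| <= B.
  exists (\sum_i \sum_j `|(x - a) i j|) => i j.
  rewrite (bigD1 i) //= (bigD1 j) //= -addrA lerDl addr_ge0 //; first exact: sumr_ge0.
  by apply: sumr_ge0 => k _; exact: sumr_ge0.
pose k := r / (`|B| + 1).
have B1 : 0 < `|B| + 1 by rewrite ltr_wpDl.
have k0 : 0 < k by rewrite divr_gt0.
exists 2%N, (fun i : 'I_2 => if i == 0 then a else a + k *: (x - a)).
exists (fun i : 'I_2 => if i == 0 then 1 - k^-1 else k^-1); split.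
- move=> i; case: eqP => _; apply: aK; first exact: ballxx.
  apply/mx_ballP => // s t; rewrite !mxE opprD addNKr normrN normrM gtr0_norm //.
  rewrite mulrAC ltr_pdivrMr // ltr_pM2l //.
  have := xB s t; rewrite !mxE => /le_lt_trans; apply.
  by rewrite (le_lt_trans (ler_norm _)) // ltrDl.
- by rewrite big_ord_recl big_ord1 /= subrK.
- rewrite big_ord_recl big_ord1 /=; apply/matrixP => s t; rewrite !mxE.
  by field; rewrite gt_eqF.
Qed.

Lemma ball_segment p q (K : set 'M[R]_(p, q)) a b r t : convex K -> 0 < r ->
  ball a r `<=` K -> K b -> 0 <= t < 1 ->
  ball ((1 - t) *: a + t *: b) ((1 - t) * r) `<=` K.
Proof.
move=> cK r0 aK Kb /andP[t0 t1] z.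
have t10 : 0 < 1 - t by rewrite subr_gt0.
rewrite mx_ballP; last exact: mulr_gt0.
move=> zb; pose a' := (1 - t)^-1 *: (z - t *: b).
have -> : z = (1 - t) *: a' + t *: b.
  by rewrite scalerA divff ?gt_eqF // scale1r subrK.
apply: cK => //; last by rewrite t0 ltW.
apply: aK; apply/mx_ballP => // i j; have := zb i j; rewrite !mxE => h.
rewrite -(ltr_pM2l t10) -{1}(gtr0_norm t10) -normrM mulrBr mulrA divff ?gt_eqF // mul1r.
by move: h; congr (`|_| < _); ring.
Qed.

(** Each basis vector is a linear combination of differences of a point of [K] and [c].
Dividing by the sum of the absolute values of the coefficients and reflecting the points
with a negative coefficient turns it into a convex combination, so a short segment around
[c] in every coordinate direction stays in [K]. *)
Lemma symmetric_ball n (K : set 'rV[R]_n) c : convex K ->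
  (forall x, K x -> K (c *+ 2 - x)) -> aff_hull K = setT ->
  exists2 r : R, 0 < r & ball c r `<=` K.
Proof.
move=> cK sK KT.
have spoke j : exists2 rho : R, 0 < rho &
    forall t : R, `|t| <= rho -> K (c + t *: delta_mx 0 j).
  have : aff_hull K (c + delta_mx 0 j) by rewrite KT.
  move=> [k [a [w [Ka w1 e]]]].
  pose S := \sum_i `|w i|.
  have S1 : 1 <= S by rewrite -w1 (le_trans (ler_norm _)) // ler_norm_sum.
  have S0 : 0 < S by rewrite (lt_le_trans ltr01).
  have Kp : K (c + S^-1 *: delta_mx 0 j).
    have -> : c + S^-1 *: delta_mx 0 j =
        \sum_i (`|w i| / S) *: (if 0 <= w i then a i else c *+ 2 - a i).
      have -> : delta_mx 0 j = \sum_i w i *: (a i - c).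
        under eq_bigr do rewrite scalerBr.
        by rewrite sumrB -e -scaler_suml w1 scale1r addrC addKr.
      have cE : c = \sum_i (`|w i| / S) *: c.
        by rewrite -scaler_suml -mulr_suml divff ?gt_eqF // scale1r.
      rewrite scaler_sumr [X in X + _ = _]cE -big_split; apply: eq_bigr => i _ /=.
      case: ifPn => [w0|]; first rewrite ger0_norm //.
        by apply/rowP => s; rewrite !mxE; ring.
      rewrite -ltNge => w0; rewrite ltr0_norm //.
      by apply/rowP => s; rewrite !mxE; ring.
    apply: convex_sum => // [i|i|]; first by case: ifP => // _; exact: sK.
      by rewrite divr_ge0 // ltW.
    by rewrite -mulr_suml divff // gt_eqF.
  have Km : K (c - S^-1 *: delta_mx 0 j).
    by have := sK _ Kp; rewrite mulr2n opprD addrA addrK.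
  exists S^-1; first by rewrite invr_gt0.
  (* [th] places the point on the segment between the two ends of the spoke *)
  move=> t tS; pose th := (1 + t * S) / 2.
  have -> : c + t *: delta_mx 0 j = (1 - th) *: (c - S^-1 *: delta_mx 0 j) +
      th *: (c + S^-1 *: delta_mx 0 j).
    apply/rowP => i; rewrite !mxE /th; field; exact: lt0r_neq0.
  have : `|t * S| <= 1 by rewrite normrM (gtr0_norm S0) -ler_pdivlMr // mul1r.
  by rewrite ler_norml => /andP[? ?]; apply: cK => //; apply/andP; split; rewrite /th; lra.
case: n => [|n] in K c cK sK KT spoke *.
  exists 1 => // x _; have : aff_hull K x by rewrite KT.
  move=> [[|k] [a [w [Ka w1 _]]]].
    by move: w1; rewrite big_ord0 => /esym/eqP; rewrite oner_eq0.
  by have := Ka ord0; congr K; apply/rowP => -[].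
pose rho j := sval (cid2 (spoke j)).
pose r := \big[Num.min/1]_j rho j.
have r0 : 0 < r.
  rewrite /r; elim/big_ind : _ => // [x y x0 y0|j _]; first by rewrite lt_min x0.
  by rewrite /rho; case: cid2.
have n0 : 0 < n.+1%:R :> R by rewrite ltr0n.
exists (r / n.+1%:R); first by rewrite divr_gt0.
move=> x; rewrite mx_ballP ?divr_gt0 // => xc.
have -> : x = \sum_j n.+1%:R^-1 *: (c + (n.+1%:R * (x 0 j - c 0 j)) *: delta_mx 0 j).
  under eq_bigr do rewrite scalerDr scalerA mulKf ?gt_eqF //.
  rewrite big_split /= sumr_const card_ord -scaler_nat scalerA.
  rewrite divff ?gt_eqF // scale1r.
  under eq_bigr do rewrite scalerBl.
  rewrite sumrB -!row_sum_delta addrC subrK //.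
apply: convex_sum => // [j|]; last first.
  by rewrite sumr_const card_ord -(mulr_natr n.+1%:R^-1) mulVf // gt_eqF.
have jr : r <= rho j by exact: bigmin_le_cond.
rewrite /rho in jr; case: cid2 jr => /= s s0 hs rs; apply: hs.
rewrite normrM gtr0_norm // -ler_pdivlMl // distrC (le_trans (ltW (xc 0 j))) //.
by rewrite mulrC ler_wpM2l // invr_ge0 ltW.
Qed.

End Affine.

(** * Faces of a prism *)

Section Shape.
Context {R : realType}.
Local Notation R2 := 'rV[R]_2.
Local Notation R3 := 'rV[R]_(2 + 1).

Definition pt (x : R2) (t : R) : R3 := row_mx x t%:M.

Definition height (z : R3) : R := rsubmx z 0 0.

Lemma pt_proj z : z = pt (proj_base z) (height z).
Proof. by rewrite /pt /height -mx11_scalar hsubmxK. Qed.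

Lemma proj_pt x t : proj_base (pt x t) = x.
Proof. exact: row_mxKl. Qed.

Lemma height_pt x t : height (pt x t) = t.
Proof. by rewrite /height row_mxKr mxE eqxx. Qed.

Lemma pt_comb a b x y t u :
  a *: pt x t + b *: pt y u = pt (a *: x + b *: y) (a * t + b * u).
Proof. by rewrite !scale_row_mx add_row_mx !scale_scalar_mx -raddfD. Qed.

Lemma height_scalar : exists l : {scalar R3}, forall z, l z = height z.
Proof. by apply: scalar_of => a u v; rewrite /height !mxE. Qed.

Lemma heightD u v : height (u + v) = height u + height v.
Proof. by rewrite /height !mxE. Qed.

Lemma heightZ a u : height (a *: u) = a * height u.
Proof. by rewrite /height !mxE. Qed.

Lemma height_sum n (c : 'I_n -> R) (a : 'I_n -> R3) :
  height (\sum_i c i *: a i) = \sum_i c i * height (a i).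
Proof. by rewrite /height mxE summxE; apply: eq_bigr => i _; rewrite !mxE. Qed.

Lemma cyl1E (A : set R2) s z : cyl A [set s] z <-> A (proj_base z) /\ height z = s.
Proof.
split=> [[x Ax [t -> <-]]|[Az <-]]; first by rewrite proj_pt height_pt.
exists (proj_base z) => //; exists (height z) => //; exact/esym/pt_proj.
Qed.

Lemma cyl_itvE (A : set R2) a b z :
  cyl A `[a, b] z <-> A (proj_base z) /\ a <= height z <= b.
Proof.
split=> [[x Ax [t]]|[Az zab]].
  by rewrite /= in_itv /= => tab <-; rewrite proj_pt height_pt.
exists (proj_base z) => //; exists (height z); first by rewrite /= in_itv.
exact/esym/pt_proj.
Qed.

Section Prism.
Context (Q : set R2) (P Q' : set R3) (Phi : set R3 -> set R3).
Hypothesis Phi_iso : face_iso (cyl Q `[0, 1]) P Phi.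
Hypothesis Phi0 : Phi (cyl Q [set 0]) = cyl Q [set 0].
Hypothesis Phi1 : Phi (cyl Q [set 1]) = Q'.
Local Notation prism := (cyl Q `[0, 1]).

Lemma face_bottom : face prism (cyl Q [set 0]).
Proof.
have [l lE] : exists l : {scalar R3}, forall z, l z = - height z.
  by apply: scalar_of => a u v; rewrite heightD heightZ; ring.
exists l, 0; split=> [z /cyl_itvE[_ /andP[z0 _]]|].
  by rewrite lE oppr_le0.
apply/seteqP; split => z.
  move=> /cyl1E[Qz z0]; split; last by rewrite /= lE z0 oppr0.
  by apply/cyl_itvE; rewrite z0 lexx ler01.
move=> [/cyl_itvE[Qz _] /= /eqP]; rewrite lE oppr_eq0 => /eqP z0.
exact/cyl1E.
Qed.

Lemma face_top : face prism (cyl Q [set 1]).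
Proof.
have [l lE] := height_scalar.
exists l, 1; split=> [z /cyl_itvE[_ /andP[_ z1]]|]; first by rewrite lE.
apply/seteqP; split => z.
  move=> /cyl1E[Qz z0]; split; last by rewrite /= lE z0.
  by apply/cyl_itvE; rewrite z0 lexx ler01.
by move=> [/cyl_itvE[Qz _] /=]; rewrite lE => z0; exact/cyl1E.
Qed.

Lemma Phi_set0 : Phi set0 = set0.
Proof.
have [[Phom Pinj Psurj] Psub] := Phi_iso.
have [F Ff PF] := Psurj _ (face0 P).
have := (Psub _ _ (face0 prism) Ff).2 (sub0set _); rewrite PF.
by rewrite subset0.
Qed.

Lemma face_P_base : face P (cyl Q [set 0]).
Proof. by have [[Phom _ _] _] := Phi_iso; rewrite -Phi0; exact/Phom/face_bottom. Qed.

Lemma face_P_top : face P Q'.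
Proof. by have [[Phom _ _] _] := Phi_iso; rewrite -Phi1; exact/Phom/face_top. Qed.

(** The intersection is a face of [P]; the corresponding face of the prism lies both in
the bottom and in the top, so it is empty. *)
Lemma base_top_disjoint z : cyl Q [set 0] z -> Q' z -> False.
Proof.
have [[Phom Pinj Psurj] Psub] := Phi_iso.
move=> z0 z1; have [F Ff PF] := Psurj _ (faceI face_P_base face_P_top).
have F0 : F `<=` cyl Q [set 0].
  by apply/(Psub _ _ Ff face_bottom); rewrite PF Phi0; exact: subIsetl.
have F1 : F `<=` cyl Q [set 1].
  by apply/(Psub _ _ Ff face_top); rewrite PF Phi1; exact: subIsetr.
have FE : F = set0.
  apply/seteqP; split => // y Fy; have /cyl1E[_ y0] := F0 _ Fy.
  have /cyl1E[_] := F1 _ Fy; rewrite y0 => /esym/eqP; by rewrite oner_eq0.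
move: PF; rewrite FE Phi_set0 => E.
by have : set0 z by rewrite E.
Qed.

(** A vertex of [P] comes from a minimal nonempty face of the prism, and such a face
meets the bottom or the top. *)
Lemma vert_base_top : vert P `<=` cyl Q [set 0] `|` Q'.
Proof.
have [[Phom Pinj Psurj] Psub] := Phi_iso.
move=> z Vz; have [F Ff PF] := Psurj _ Vz.
have Fmin G : face prism G -> G `<=` F -> G !=set0 -> F `<=` G.
  move=> Gf GF [y Gy]; have : Phi G `<=` [set z] by rewrite -PF; exact/Psub.
  move=> /subset_set1[] PG.
    have : G = set0.
      by apply: Pinj; rewrite ?inE ?Phi_set0 //; exact: face0.
    by move=> G0; move: Gy; rewrite G0.
  suff -> : F = G by [].
  by apply: Pinj; rewrite ?inE // PF.
have [F0|F0] := pselect ((F `&` cyl Q [set 0]) !=set0).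
  left; have := Fmin _ (faceI Ff face_bottom) (@subIsetl _ _ _) F0.
  move=> /subset_trans/(_ (@subIsetr _ _ _))/(Psub _ _ Ff face_bottom).
  by rewrite PF Phi0; exact.
have [F1|F1] := pselect ((F `&` cyl Q [set 1]) !=set0).
  right; have := Fmin _ (faceI Ff face_top) (@subIsetl _ _ _) F1.
  move=> /subset_trans/(_ (@subIsetr _ _ _))/(Psub _ _ Ff face_top).
  by rewrite PF Phi1; exact.
have [y Fy] : F !=set0.
  apply/set0P/negP => /eqP FE; move: PF; rewrite FE Phi_set0 => E.
  by have : set0 z by rewrite E.
(* Otherwise the functional defining [F] attains its maximum at an interior height, so
   it is constant along the vertical segment, whose lower end is then in [F]. *)
exfalso; move: Ff => [l [c [lc FE]]]; move: Fy (Fy); rewrite {1}FE => -[Py /= ly] Fy.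
have /cyl_itvE[Qy /andP[y0 y1]] := Py.
have Hp s : 0 <= s <= 1 -> prism (pt (proj_base y) s).
  by move=> ?; apply/cyl_itvE; rewrite proj_pt height_pt.
have l0 := lc _ (Hp 0 _); rewrite lexx ler01 in l0.
have l1 := lc _ (Hp 1 _); rewrite lexx ler01 in l1.
have yE : y = (1 - height y) *: pt (proj_base y) 0 + height y *: pt (proj_base y) 1.
  by rewrite pt_comb mulr0 add0r mulr1 -scalerDl subrK scale1r -pt_proj.
have lE := ly; rewrite yE linearD !linearZ /= in lE.
have [h1|h1] := eqVneq (height y) 1.
  by apply: F1; exists y; split => //; exact/cyl1E.
have {}h1 : height y < 1 by rewrite lt_neqAle h1.
apply: F0; exists (pt (proj_base y) 0); split.
  rewrite FE; split; first by apply: Hp; rewrite lexx ler01.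
  move: (l0 isT) (l1 isT) lE; rewrite /=; nra.
by apply/cyl1E; rewrite proj_pt height_pt.
Qed.

End Prism.
End Shape.

(** * The shape of a slant-truncated prism *)

Section Truncated.
Context {R : realType}.
Local Notation R2 := 'rV[R]_2.
Local Notation R3 := 'rV[R]_(2 + 1).

Lemma rel_boundary_intro n (K : set 'rV[R]_n) x : aff_hull K = setT -> K x ->
  (forall r, 0 < r -> ~ ball x r `<=` K) -> rel_boundary K x.
Proof.
move=> KT Kx nb; split; first exact: subset_closure.
move=> [_ /nbhs_ballP[r /= r0 rK]]; apply: (nb _ r0) => y /rK /=.
by apply; rewrite KT.
Qed.

Lemma rel_boundary_ball n (K : set 'rV[R]_n) x r : 0 < r -> ball x r `<=` K ->
  rel_boundary K x -> False.
Proof.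
move=> r0 xK [_]; apply; split; first by apply: xK; exact: ballxx.
by apply/nbhs_ballP; exists r => // y /xK.
Qed.

(** A point with a neighbourhood inside [K] is a midpoint of two other points of [K]. *)
Lemma extreme_boundary n (K : set 'rV[R]_n.+1) x : aff_hull K = setT ->
  extreme K x -> rel_boundary K x.
Proof.
move=> KT [Kx xe]; apply: rel_boundary_intro => // r r0 xK.
pose d : 'rV[R]_n.+1 := const_mx (r / 2).
have Kd s : `|s| <= 1 -> K (x + s *: d).
  move=> s1; apply: xK; apply/mx_ballP => // i j; rewrite !mxE opprD addNKr normrN.
  rewrite normrM (gtr0_norm (x := r / 2)) ?divr_gt0 //.
  apply: (le_lt_trans (y := r / 2)); first by rewrite ler_piMl // divr_ge0 // ltW.
  by move: r0; lra.
have : x + 1 *: d = x.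
  apply: (xe _ (x + (- 1) *: d)).
  - by apply: Kd; rewrite normr1.
  - by apply: Kd; rewrite normrN normr1.
  by apply/rowP => i; rewrite !mxE; field.
move/rowP => /(_ 0); rewrite !mxE => /eqP.
by rewrite mul1r -subr_eq0 addrAC subrr add0r gt_eqF // divr_gt0.
Qed.

Section Shape.
Context (Q : set R2) (P Q' : set R3) (eps : R) (c : R2) (r : R).
Hypothesis Q_polytope : polytope Q.
Hypothesis r_gt0 : 0 < r.
Hypothesis ball_Q : ball c r `<=` Q.
Hypothesis P_polytope : polytope P.
Hypothesis eps_gt0 : 0 < eps.
Hypothesis P_right : cyl (rel_boundary Q) `[0, eps] `<=` rel_boundary P.
Hypothesis face_base : face P (cyl Q [set 0]).
Hypothesis face_top : face P Q'.
Hypothesis disjoint : forall z, cyl Q [set 0] z -> Q' z -> False.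
Hypothesis vertP : vert P `<=` cyl Q [set 0] `|` Q'.

Let QT : aff_hull Q = setT := ball_aff_hull r_gt0 ball_Q.
Let cQ : convex Q := polytope_convex Q_polytope.
Let cP : convex P := polytope_convex P_polytope.

Lemma pt_split (x : R2) t : pt x t = pt x 0 + t *: pt 0 1.
Proof. by rewrite -[pt x 0]scale1r pt_comb scale1r scaler0 addr0 mulr0 add0r mulr1. Qed.

Lemma base_scalar (l : {scalar R3}) : exists m : {scalar R2}, forall x, m x = l (pt x 0).
Proof.
apply: scalar_of => a u w; rewrite (_ : pt _ 0 = a *: pt u 0 + 1 *: pt w 0).
  by rewrite linearD !linearZ /= mul1r.
by rewrite pt_comb scale1r !mulr0 addr0.
Qed.

Lemma pt_segment x s t a b : P (pt x a) -> P (pt x b) -> 0 <= s <= 1 ->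
  t = (1 - s) * a + s * b -> P (pt x t).
Proof.
move=> Pa Pb s01 ->; have := cP Pa Pb s01.
by rewrite pt_comb -scalerDl subrK scale1r.
Qed.

Lemma base_P x : Q x -> P (pt x 0).
Proof. by move=> Qx; apply: (face_sub face_base); apply/cyl1E; rewrite proj_pt height_pt. Qed.

Lemma wall_P x t : rel_boundary Q x -> 0 <= t <= eps -> rel_boundary P (pt x t).
Proof. by move=> bx tb; apply: P_right; apply/cyl_itvE; rewrite proj_pt height_pt. Qed.

(** The vertices of [Q] are boundary points, so the walls reach the height [eps] above
all of them. *)
Lemma roof_P x : Q x -> P (pt x eps).
Proof.
move=> Qx; have := polytope_conv_vert Q_polytope Qx.
apply: (@conv_hull_min _ _ _ [set y | P (pt y eps)]) => [y z t /= Py Pz t01|v Vv /=].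
  have := cP Py Pz t01; rewrite pt_comb; congr (P (pt _ _)); ring.
have [] := wall_P (t := eps) (extreme_boundary QT (vert_extreme Vv)).
  by rewrite lexx ltW.
by move=> clP _; exact: (compact_mx_closed (polytope_compact P_polytope) clP).
Qed.

Lemma slab_P x t : Q x -> 0 <= t <= eps -> P (pt x t).
Proof.
move=> Qx /andP[t0 te]; apply: (@pt_segment _ (t / eps) _ _ _ (base_P Qx) (roof_P Qx)).
  by rewrite divr_ge0 ?(ltW eps_gt0) //= ler_pdivrMr // mul1r.
by rewrite mulr0 add0r divfK // gt_eqF.
Qed.

(** A functional supporting [P] along [Q * 0] is constant on the plane spanned by
[Q * 0], so it only depends on the height; it decreases with the height because [P]
contains points above [Q]. *)
Lemma height_ge0 z : P z -> 0 <= height z.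
Proof.
have [l [b [lb E]]] := face_base; move=> Pz.
have bE x : Q x -> l (pt x 0) = b.
  move=> Qx; have : cyl Q [set 0] (pt x 0) by apply/cyl1E; rewrite proj_pt height_pt.
  by rewrite E => -[].
have lE y t : l (pt y t) = l (pt y 0) + t * l (pt 0 1).
  by rewrite {1}pt_split linearD linearZ.
have : aff_hull Q (proj_base z) by rewrite QT.
have Qc : Q c by apply: ball_Q; exact: ballxx.
have k0 : l (pt 0 1) < 0.
  have := lb _ (roof_P Qc); rewrite lE bE // gerDl pmulr_rle0 // le_eqVlt => /orP[/eqP k0|//].
  have : cyl Q [set 0] (pt c eps).
    by rewrite E; split; [exact: roof_P|rewrite /= lE bE // k0 mulr0 addr0].
  by move=> /cyl1E[_]; rewrite height_pt => /eqP; rewrite gt_eqF.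
move=> [k [a [w [Qa w1 e]]]].
have z0 : l (pt (proj_base z) 0) = b.
  have [m mE] := base_scalar l.
  rewrite -mE e linear_sum -[RHS]mul1r -w1 mulr_suml; apply: eq_bigr => i _.
  by rewrite linearZ /= mE bE.
have := lb _ Pz; rewrite (pt_proj z) lE z0 height_pt gerDl nmulr_lle0 //.
Qed.

(** A point of [P] over the complement of [Q] would, together with an interior point
of the slab [Q * [0, eps]], make some point of the vertical wall interior. *)
Lemma proj_P z : P z -> Q (proj_base z).
Proof.
move=> Pz; apply: contrapT => nQ; set y := proj_base z in nQ.
pose t := height z.
have t0 : 0 <= t by exact: height_ge0.
have zE : z = pt y t by exact: pt_proj.
pose T := `[0, 1]%classic `&` (fun s : R => c + s *: (y - c)) @^-1` Q.
have Qcl : closed Q by apply: compact_mx_closed; exact: polytope_compact.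
have idC : continuous (@id R) by move=> x; exact: cvg_id.
have lineC : continuous (fun s : R => c + s *: (y - c)).
  apply: mx_continuous => i j; under eq_fun do rewrite mxE [X in _ + X]mxE.
  apply: add_cont; first exact: cst_cont.
  by apply: (mul_cont (f := id)); [exact: idC|exact: cst_cont].
have cT : compact T.
  apply: (subclosed_compact _ (@segment_compact R 0 1)); last by move=> x [].
  apply: closedI; first exact: (compact_closed (@norm_hausdorff _ _) (@segment_compact R 0 1)).
  by apply: closed_comp => // s _; exact: lineC.
have Qc : Q c by apply: ball_Q; exact: ballxx.
have T0 : T !=set0.
  by exists 0; split; [rewrite /= in_itv /= lexx ler01|rewrite /= scale0r addr0].
have [tau] := @compact_EVT_max _ R id _ T0 cT (continuous_subspaceT idC).
rewrite inE => -[/=]; rewrite in_itv /= => /andP[tau0 tau1] Qtau taumax.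
(* [tau] is the last parameter at which the segment from [c] to [y] is in [Q]. *)
have {}tau1 : tau < 1.
  rewrite lt_neqAle tau1 andbT; apply/eqP => tauE; apply: nQ.
  by move: Qtau; rewrite tauE scale1r addrC subrK.
pose b := c + tau *: (y - c).
have bb : rel_boundary Q b.
  apply: rel_boundary_intro => // rho rho0 bQ.
  pose S := \sum_i `|(y - c) 0 i| + 1.
  have S0 : 0 < S by rewrite ltr_wpDl // sumr_ge0.
  pose d := Num.min (1 - tau) (rho / (2 * S)).
  have d0 : 0 < d by rewrite lt_min subr_gt0 tau1 /= divr_gt0 // mulr_gt0.
  have /taumax : (tau + d) \in T; last by rewrite gerDl leNgt d0.
  rewrite inE; split => /=.
    rewrite in_itv /= addr_ge0 ?(ltW d0) //= -lerBrDl.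
    by rewrite /d ge_min lexx.
  apply: bQ; apply/mx_ballP => // i j; rewrite ord1 {i}.
  rewrite (_ : _ - _ = - (d * (y - c) 0 j)); last by rewrite /b !mxE; ring.
  rewrite normrN normrM gtr0_norm //.
  have dS : d * S <= rho / 2.
    rewrite -ler_pdivlMr //; apply: (le_trans (y := rho / (2 * S))).
      by rewrite /d ge_min lexx orbT.
    by rewrite invfM mulrA.
  apply: (le_lt_trans (y := d * S)); last first.
    by apply: le_lt_trans dS _; move: rho0; lra.
  rewrite ler_pM2l //= /S (bigD1 j) //= -addrA lerDl addr_ge0 //; exact: sumr_ge0.
(* First go from [b] towards the point [z] by a fraction [th] that keeps the height below
   [eps]; the segment from an interior point above [c] to the point so reached crosses
   the wall above [b] at the parameter [s]. *)
pose th := eps / (eps + t).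
have et0 : 0 < eps + t by rewrite ltr_wpDr.
have th0 : 0 < th by rewrite divr_gt0.
have th1 : th <= 1 by rewrite ler_pdivrMr // mul1r lerDl.
have tht : th * t <= eps.
  by rewrite /th mulrAC ler_pdivrMr // ler_pM2l // lerDr ltW.
pose m := tau + th * (1 - tau).
have m0 : 0 < m by rewrite ltr_wpDl // mulr_gt0 // subr_gt0.
have taum : tau < m by rewrite ltrDl mulr_gt0 // subr_gt0.
pose s := tau / m.
have s0 : 0 <= s by rewrite divr_ge0 // ltW.
have s1 : s < 1 by rewrite ltr_pdivrMr // mul1r.
have Pw : P ((1 - th) *: pt b 0 + th *: z).
  by apply: cP => //; [exact: base_P|rewrite ltW].
pose rr := Num.min r (eps / 2).
have rr0 : 0 < rr by rewrite lt_min r_gt0 divr_gt0.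
have Pb : ball (pt c (eps / 2)) rr `<=` P.
  move=> w; rewrite mx_ballP // => wc; rewrite (pt_proj w); apply: slab_P.
    apply: ball_Q; apply/mx_ballP => // i j; have := wc 0 (lshift 1 j).
    rewrite ord1 /pt row_mxEl /proj_base mxE => /lt_le_trans; apply.
    by rewrite ge_min lexx.
  have := wc 0 (rshift 2 0); rewrite /pt row_mxEr mxE eqxx mulr1n => h.
  have {h} : `|eps / 2 - height w| < eps / 2.
    rewrite /height mxE; apply: lt_le_trans h _; by rewrite ge_min lexx orbT.
  by rewrite ltr_norml => /andP[? ?]; apply/andP; split; lra.
have s01 : 0 <= s < 1 by rewrite s0.
have := ball_segment cP rr0 Pb Pw s01.
set w := (X in ball X _) => wP.
have wE : w = pt b ((1 - s) * (eps / 2) + s * (th * t)).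
  rewrite /w zE !pt_comb mulr0 add0r; congr (pt _ _).
  have sm : s * m = tau by rewrite divfK // gt_eqF.
  apply/rowP => i; apply/eqP; rewrite -subr_eq0; apply/eqP.
  transitivity ((s * m - tau) * (y 0 i - c 0 i)); last by rewrite sm subrr mul0r.
  by rewrite /m /b !mxE; ring.
rewrite wE in wP; apply: (rel_boundary_ball _ wP).
  by rewrite mulr_gt0 // subr_gt0.
have tht0 : 0 <= th * t by rewrite mulr_ge0 // ltW.
apply: wall_P => //; apply/andP; split; move: s0 s1 tht tht0 eps_gt0; nra.
Qed.

(** The wall over a vertex [v] of [Q] can only be spanned by points of [P] over [v],
and one of them has to lie in the top facet. *)
Lemma vert_lift v : vert Q v -> exists2 t, 0 < t & Q' (pt v t).
Proof.
move=> [l [b [lb vE]]].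
have Qv : Q v by have : [set v] v by []; rewrite vE => -[].
have lv : l v = b by have : [set v] v by []; rewrite vE => -[].
have [k [a [w [Va w0 w1 e]]]] := polytope_conv_vert P_polytope (roof_P Qv).
have aP i : P (a i) by exact: vert_sub.
have av i : w i != 0 -> proj_base (a i) = v.
  move=> wi; suff : [set v] (proj_base (a i)) by [].
  rewrite vE; split; first exact: proj_P.
  apply: (face_conv_comb (a := fun i => proj_base (a i)) _ w0 w1 _ wi).
    by move=> j; apply: lb; exact: proj_P.
  rewrite -lv -[v](proj_pt v eps) e /proj_base [in RHS]linear_sum; congr (l _).
  by apply: eq_bigr => j _; rewrite linearZ.
have : \sum_i w i * height (a i) = eps by rewrite -height_sum -e height_pt.
have [[i [wi hi]] _|none s0] := pselect (exists i, w i != 0 /\ 0 < height (a i)).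
  exists (height (a i)) => //; rewrite -(av _ wi) -pt_proj.
  have [/cyl1E[_ h0]|//] := vertP (Va i).
  by move: hi; rewrite h0 ltxx.
move: eps_gt0; rewrite -s0 big1 ?ltxx // => i _.
have [->|wi] := eqVneq (w i) 0; first by rewrite mul0r.
have -> : height (a i) = 0; last by rewrite mulr0.
apply/eqP; rewrite eq_le height_ge0 // andbT leNgt; apply/negP => hi.
by apply: none; exists i.
Qed.

(** The facet [Q'] lies in a supporting plane of [P]. As [Q'] has a point above every
vertex of [Q] but none in [Q * 0], this plane is not vertical, and solving its equation
for the height gives the function [eta] whose graph over [Q] is [Q']. *)
Lemma truncated_prism : exists eta : 'cV[R]_(1 + 2),
  [/\ forall x, Q x -> 0 < ev eta x,
      forall x t, P (pt x t) <-> Q x /\ 0 <= t <= ev eta x &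
      Q' = [set pt x (ev eta x) | x in Q]].
Proof.
have [l [b [lb E]]] := face_top.
pose k := l (pt 0 1).
have lE y t : l (pt y t) = l (pt y 0) + t * k.
  by rewrite {1}pt_split linearD linearZ.
have Qc : Q c by apply: ball_Q; exact: ballxx.
have [v Vv] : vert Q !=set0.
  apply/set0P/negP => /eqP V0; have := polytope_conv_vert Q_polytope Qc.
  rewrite V0 => -[[|j] [a [w [Va w1 w2 _]]]]; last by have := Va ord0.
  by move: w2; rewrite big_ord0 => /esym/eqP; rewrite oner_eq0.
have Qlb z : Q' z -> P z /\ l z = b by rewrite {1}E.
have k0 : 0 < k.
  have [t t0 Qt] := vert_lift Vv.
  have [Pt lt] := Qlb _ Qt; rewrite lE in lt.
  have Qv : Q v by exact: vert_sub.
  have := lb _ (base_P Qv); rewrite -lt lerDl pmulr_rge0 // le_eqVlt => /orP[/eqP k0|//].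
  exfalso; apply: (disjoint (z := pt v 0)); first by apply/cyl1E; rewrite proj_pt height_pt.
  by rewrite E; split; [exact: base_P|rewrite /= -lt -k0 mulr0 addr0].
have [m mE] := base_scalar l.
have [l' l'E] : exists l' : {scalar R2}, forall x, l' x = - k^-1 * l (pt x 0).
  by apply: scalar_of => a u w; rewrite -!mE linearP /=; ring.
have [eta etaE] := ev_exists (b / k) l'.
have lb' x t : (l (pt x t) <= b) = (t <= ev eta x).
  rewrite lE etaE l'E -lerBrDl -ler_pdivlMr //; congr (_ <= _); field; exact: lt0r_neq0.
have lbE x t : (l (pt x t) = b) <-> (t = ev eta x).
  rewrite lE etaE l'E; split => [<-|->]; field; exact: lt0r_neq0.
have vpos x : vert Q x -> 0 < ev eta x /\ Q' (pt x (ev eta x)).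
  move=> Vx; have [t t0 Qt] := vert_lift Vx.
  by have [_ /lbE <-] := Qlb _ Qt.
have pos x : Q x -> 0 < ev eta x.
  move=> /(polytope_conv_vert Q_polytope).
  apply: (@conv_hull_min _ _ _ [set y | 0 < ev eta y]) => [y z t /= py pz /andP[t0 t1]|y /vpos[]//].
  by rewrite ev_comb ?subrK //; move: py pz t0 t1; nra.
have top x : Q x -> P (pt x (ev eta x)).
  move=> /(polytope_conv_vert Q_polytope).
  apply: (@conv_hull_min _ _ _ [set y | P (pt y (ev eta y))]) => [y z t /= py pz t01|y /vpos[_]].
    by rewrite ev_comb ?subrK // -pt_comb; exact: cP.
  by move/Qlb => [].
have PE x t : P (pt x t) <-> Q x /\ 0 <= t <= ev eta x.
  split=> [Pxt|[Qx /andP[t0 tx]]].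
    split; first by have := proj_P Pxt; rewrite proj_pt.
    by have := height_ge0 Pxt; rewrite height_pt => -> /=; rewrite -lb'; exact: lb.
  apply: (@pt_segment _ (t / ev eta x) _ _ _ (base_P Qx) (top _ Qx)).
    by rewrite divr_ge0 ?(ltW (pos _ Qx)) //= ler_pdivrMr ?mul1r // pos.
  by rewrite mulr0 add0r divfK // gt_eqF // pos.
exists eta; split => //.
apply/seteqP; split => [z /[dup] Qz|_ [x Qx <-]].
  move=> /Qlb[Pz]; rewrite {1}(pt_proj z) => /lbE hz.
  by exists (proj_base z); [exact: proj_P|rewrite -hz -pt_proj].
by rewrite E; split; [exact: top|exact/lbE].
Qed.

End Shape.
End Truncated.

(** * Mean values *)

Section Mean.
Context d {T : measurableType d} {R : realType}.
Context (mu : {measure set T -> \bar R}) (D : set T).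
Implicit Types f g : T -> R.

Definition mean f : R := (fine (mu D))^-1 * \int[mu]_(x in D) f x.

(** Boundedness on [D] is what makes these functions integrable on a set of finite
measure. *)
Definition bmeas f := measurable_fun D f /\ exists B, forall x, D x -> `|f x| <= B.

Lemma eq_bmeas f g : (forall x, D x -> f x = g x) -> bmeas f -> bmeas g.
Proof.
move=> fg [mf [B fB]]; split.
  by apply: eq_measurable_fun mf => x; rewrite inE; exact: fg.
by exists B => x Dx; rewrite -fg // fB.
Qed.

Lemma bmeas_cst k : bmeas (fun=> k).
Proof. by split; [exact: measurable_cst|exists `|k|]. Qed.

Lemma bmeasD f g : bmeas f -> bmeas g -> bmeas (fun x => f x + g x).
Proof.
move=> [mf [A fA]] [mg [B gB]]; split; first exact: measurable_funD.
by exists (A + B) => x Dx; rewrite (le_trans (ler_normD _ _)) // lerD // (fA, gB).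
Qed.

Lemma bmeasZ k f : bmeas f -> bmeas (fun x => k * f x).
Proof.
move=> [mf [A fA]]; split; first by apply: measurable_funM => //; exact: measurable_cst.
by exists (`|k| * A) => x Dx; rewrite normrM ler_wpM2l // fA.
Qed.

Lemma bmeas_sum (I : Type) (s : seq I) (P : pred I) (F : I -> T -> R) :
  (forall i, bmeas (F i)) -> bmeas (fun x => \sum_(i <- s | P i) F i x).
Proof.
move=> bF; elim: s => [|i s IHs].
  by under eq_fun do rewrite big_nil; exact: bmeas_cst.
under eq_fun do rewrite big_cons; case: (P i) => //.
exact: bmeasD.
Qed.

Hypothesis mD : measurable D.
Hypothesis D_gt0 : (0 < mu D)%E.
Hypothesis D_fin : (mu D < +oo)%E.

Lemma bmeas_integrable f : bmeas f -> mu.-integrable D (EFin \o f).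
Proof.
move=> [mf [B fB]]; apply: measurable_bounded_integrable => //.
exists B; split; first exact: num_real.
by move=> M BM x Dx; apply: le_trans (ltW BM); exact: fB.
Qed.

Lemma fine_gt0D : 0 < fine (mu D).
Proof. by apply: fine_gt0; rewrite D_gt0. Qed.

Lemma eq_mean f g : (forall x, D x -> f x = g x) -> mean f = mean g.
Proof. by move=> fg; congr (_ * _); apply: eq_Rintegral => x; rewrite inE; exact: fg. Qed.

Lemma mean_cst k : mean (fun=> k) = k.
Proof. by rewrite /mean Rintegral_cst // mulrCA mulVf ?mulr1 // gt_eqF // fine_gt0D. Qed.

Lemma meanD f g : bmeas f -> bmeas g -> mean (fun x => f x + g x) = mean f + mean g.
Proof.
move=> /bmeas_integrable bf /bmeas_integrable bg; rewrite /mean RintegralD //.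
exact: mulrDr.
Qed.

Lemma meanZ k f : bmeas f -> mean (fun x => k * f x) = k * mean f.
Proof.
move=> /bmeas_integrable bf; rewrite /mean RintegralZl //.
exact: mulrCA.
Qed.

Lemma mean_sum (I : Type) (s : seq I) (P : pred I) (F : I -> T -> R) :
  (forall i, bmeas (F i)) ->
  mean (fun x => \sum_(i <- s | P i) F i x) = \sum_(i <- s | P i) mean (F i).
Proof.
move=> bF; elim: s => [|i s IHs].
  by rewrite big_nil; under [X in mean X]eq_fun do rewrite big_nil; rewrite mean_cst.
rewrite big_cons; under [X in mean X]eq_fun do rewrite big_cons.
by case: (P i) => //; rewrite -IHs meanD //; exact: bmeas_sum.
Qed.

Lemma mean_le f g : bmeas f -> bmeas g -> (forall x, D x -> f x <= g x) ->
  mean f <= mean g.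
Proof.
move=> bf bg fg; rewrite ler_wpM2l ?invr_ge0 ?(ltW fine_gt0D) //.
by apply: le_Rintegral => //; exact: bmeas_integrable.
Qed.

(** The difference of the two functions is at least [e] times the indicator function of
[O]. *)
Lemma mean_lt f g (O : set T) (e : R) : bmeas f -> bmeas g ->
  (forall x, D x -> f x <= g x) -> measurable O -> O `<=` D -> (0 < mu O)%E ->
  0 < e -> (forall x, O x -> f x + e <= g x) -> mean f < mean g.
Proof.
move=> bf bg fg mO OD O0 e0 fgO.
have bO : bmeas (\1_O : T -> R).
  split; first exact: measurable_indic.
  by exists 1 => x _; rewrite indicE normr_nat; case: (_ \in _); rewrite ?ler01.
have : mean (fun x => f x + e * \1_O x) <= mean g.
  apply: mean_le => //; first by apply: bmeasD => //; exact: bmeasZ.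
  move=> x Dx; rewrite indicE; case: (boolP (x \in O)) => [|_].
    by rewrite inE mulr1; exact: fgO.
  by rewrite mulr0 addr0 fg.
apply: lt_le_trans; rewrite meanD ?meanZ //; last exact: bmeasZ.
rewrite ltrDl mulr_gt0 // mulr_gt0 ?invr_gt0 ?fine_gt0D //.
rewrite /Rintegral integral_indic // setIidl //; apply: fine_gt0; rewrite O0 /=.
by apply: le_lt_trans D_fin; apply: le_measure; rewrite ?inE.
Qed.

End Mean.

(** * Borel sets and invariant measures on spaces of matrices *)

Section BorelMatrix.
Context {R : realType} {p q : nat}.
Local Notation W := 'M[R]_(p, q).

Lemma open_borel (O : set W) : open O -> measurable (O : set (borel W)).
Proof. by move=> oO; exact: sub_sigma_algebra. Qed.

Lemma closed_borel (C : set W) : closed C -> measurable (C : set (borel W)).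
Proof.
move=> cC; rewrite -[C]setCK; apply: measurableC; apply: open_borel.
exact: closed_openC.
Qed.

Lemma continuous_borel (f : W -> R) : continuous f ->
  measurable_fun setT (f : borel W -> R).
Proof.
move=> /continuousP cf; apply: (measurability _ (RGenOpens.measurableE R)).
move=> _ [_ [a [b ->] <-]]; rewrite setTI; apply: open_borel.
exact/cf/interval_open.
Qed.

Lemma continuous_mx_borel r s (f : W -> 'M[R]_(r, s)) : continuous f ->
  measurable_fun setT (f : borel W -> borel 'M[R]_(r, s)).
Proof.
move=> /continuousP cf.
apply: (@measurability _ _ (borel W) (borel 'M[R]_(r, s)) setT f
  (@open 'M[R]_(r, s)) erefl).
by move=> _ [U oU <-]; rewrite setTI; apply: open_borel; exact: cf.
Qed.

Lemma rat_mx_dense (M : W) (e : R) : 0 < e ->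
  exists N : 'M[rat]_(p, q), ball M e (map_mx ratr N).
Proof.
move=> e0; have h i j : exists r : rat, `|M i j - ratr r| < e.
  have [|r] := @rat_in_itvoo R (M i j) (M i j + e); first by rewrite ltrDl.
  rewrite in_itv /= => /andP[r1 r2]; exists r.
  by rewrite distrC gtr0_norm ?subr_gt0 // ltrBlDl.
pose N : 'M[rat]_(p, q) := \matrix_(i, j) sval (cid (h i j)).
by exists N; apply/mx_ballP => // i j; rewrite !mxE; case: cid.
Qed.

Lemma open_ball (O : set W) a : open O -> O a ->
  exists2 e : R, 0 < e & ball a e `<=` O.
Proof. by rewrite openE => oO /oO /nbhs_ballP[e e0 eO]; exists e. Qed.

(** An open set is a countable union of balls with rational centres, and such a ball is a
product of intervals. *)
Lemma measurable_mx d (T : measurableType d) (D : set T) (f : T -> W) :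
  (forall i j, measurable_fun D (fun x => f x i j)) ->
  measurable_fun D (f : T -> borel W).
Proof.
move=> mf mD; move: mD (mD) => mD.
apply: (@measurability _ _ T (borel W) D f (@open W) erefl) => //.
move=> _ [U oU <-].
pose F (u : 'M[rat]_(p, q) * nat) : set T :=
  if `[< ball (map_mx ratr u.1 : W) u.2.+1%:R^-1 `<=` U >] then
    D `&` f @^-1` ball (map_mx ratr u.1 : W) u.2.+1%:R^-1 else set0.
rewrite [X in measurable X](_ : _ = \bigcup_u F u).
  apply: countable_bigcupT_measurable => // u; rewrite /F; case: ifP => // _.
  have u0 : 0 < u.2.+1%:R^-1 :> R by rewrite invr_gt0 ltr0n.
  rewrite [X in measurable X](_ : _ = D `&` \bigcap_(ij in [set: 'I_p * 'I_q])
     (D `&` (fun x => f x ij.1 ij.2) @^-1`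
       (ball (map_mx ratr u.1 ij.1 ij.2 : R) u.2.+1%:R^-1))).
    apply: measurableI => //; apply: fin_bigcap_measurable => // ij _.
    by apply: mf => //; apply: open_measurable; exact: ball_open.
  apply/seteqP; split => x.
    by move=> [Dx]; rewrite /= mx_ballP // => h; split => // -[i j] _; split => //=; exact: h.
  move=> [Dx h]; split => //=; apply/mx_ballP => // i j.
  by have [_] := h (i, j) I.
apply/seteqP; split => x; last first.
  by move=> [u _]; rewrite /F; case: ifPn => // /asboolP uU [Dx /uU].
move=> [Dx /= Ufx]; have [e e0 eU] := open_ball oU Ufx.
have [n /= n0] := (near_infty_natSinv_lt (PosNum (divr_gt0 e0 (ltr0n R 2)))).
move=> /(_ n (leqnn n)) /= ne.
have nn : 0 < n.+1%:R^-1 :> R by rewrite invr_gt0 ltr0n.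
have [N /ball_sym fN] := rat_mx_dense (f x) nn.
exists (N, n) => //; rewrite /F; case: ifPn => [_|/asboolPn[]]; first by split.
move=> y Ny; apply: eU; apply: (@ball_splitr _ _ (map_mx ratr N : W)).
  by apply: le_ball fN; exact: ltW.
by apply: le_ball Ny; exact: ltW.
Qed.

Lemma coord_borel i j : measurable_fun setT (fun M : borel W => (M : W) i j).
Proof. by apply: continuous_borel; exact: coord_continuous. Qed.

(** Countably many translates of a ball cover the whole space, so a null ball would make
an invariant measure vanish. *)
Lemma translation_invariant_gt0 (mu : {measure set (borel W) -> \bar R}) (O : set W) :
  translation_invariant setT mu -> open O -> O !=set0 -> (0 < mu O)%E.
Proof.
move=> [_ muT _ mu_inv] oO [a Oa]; have [e e0 eO] := open_ball oO Oa.
rewrite lt0e measure_ge0 andbT; apply/eqP => O0.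
have mB b : measurable (ball b e : set (borel W)) by apply: open_borel; exact: ball_open.
have Ba : mu (ball a e) = 0%E.
  apply/eqP; rewrite -measure_le0 -O0; apply: le_measure; rewrite ?inE //.
  exact: open_borel.
have Bb b : mu (ball b e) = 0%E.
  rewrite -Ba -[RHS](mu_inv b a) //; congr (mu _).
  apply/seteqP; split => [x /= xb|_ [x xb <-]]; have {xb} bx := (mx_ballP _ _ e0).1 xb.
    exists (x - (b - a)); last by rewrite subrK.
    apply/mx_ballP => // i j; rewrite !mxE; apply: le_lt_trans (bx i j).
    by rewrite le_eqVlt; apply/orP; left; apply/eqP; congr `|_|; ring.
  apply/mx_ballP => // i j; rewrite !mxE; apply: le_lt_trans (bx i j).
  by rewrite le_eqVlt; apply/orP; left; apply/eqP; congr `|_|; ring.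
pose F n : set (borel W) := if unpickle n is Some N
  then ball (map_mx ratr (N : 'M[rat]_(p, q)) : W) e else set0.
have : mu.-negligible (\bigcup_n F n).
  apply: negligible_bigcup => n; rewrite /F; case: unpickle => [N|].
    by apply/negligibleP => //; exact: Bb.
  exact: negligible_set0.
have -> : \bigcup_n F n = setT.
  apply/seteqP; split => // x _; have [N xN] := rat_mx_dense x e0.
  by exists (pickle N) => //; rewrite /F pickleK; exact: ball_sym.
by move/(negligibleP _ measurableT) => T0; move: muT; rewrite T0 ltxx.
Qed.

End BorelMatrix.

(** * Fibers as sets of means of sections *)

Section Fiber.
Context {R : realType} {p q r s : nat}.
Local Notation V := 'M[R]_(p, q).
Local Notation W := 'M[R]_(r, s).
Context (mu : {measure set (borel W) -> \bar R}) (g : {linear V -> W}) (X : set V).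
Local Notation D := (g @` X : set (borel W)).

Definition vmean (gam : W -> V) : V :=
  \matrix_(i, j) mean mu D (fun y : borel W => gam y i j).

Lemma fiberP (m : V) : fiber mu g X m <->
  exists2 gam : W -> V, borel_sections g X gam & m = vmean gam.
Proof.
have E (gam : W -> V) : (fine (mu D))^-1 *: mx_integral mu D gam = vmean gam.
  by apply/matrixP => i j; rewrite !mxE.
by split=> [[gam sg <-]|[gam sg ->]]; exists gam => //; rewrite E.
Qed.

Hypothesis mD : measurable D.
Hypothesis D_gt0 : (0 < mu D)%E.
Hypothesis D_fin : (mu D < +oo)%E.
Hypothesis X_bounded : exists B : R, forall M, X M -> forall i j, `|M i j| <= B.

Lemma section_bmeas (gam : W -> V) : borel_sections g X gam ->
  forall i j, bmeas D (fun y : borel W => gam y i j).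
Proof.
move=> [mg gX gE] i j; split.
  exact: (@measurable_comp _ _ _ _ _ _ setT (fun M : borel V => (M : V) i j) D gam
    measurableT _ (coord_borel i j) mg).
have [B XB] := X_bounded; exists B => y Dy; apply: XB.
by apply: gX; exists y.
Qed.

Lemma section_scalar_bmeas (gam : W -> V) (l : {scalar V}) : borel_sections g X gam ->
  bmeas D (fun y : borel W => l (gam y)).
Proof.
move=> sg; under eq_fun do rewrite scalar_mxE.
do 2!apply: bmeas_sum => ?.
by under eq_fun do rewrite mulrC; apply: bmeasZ; exact: section_bmeas.
Qed.

(** Integration is defined entrywise, so it commutes with linear functionals. *)
Lemma scalar_vmean (gam : W -> V) (l : {scalar V}) : borel_sections g X gam ->
  l (vmean gam) = mean mu D (fun y : borel W => l (gam y)).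
Proof.
move=> sg; under [X in mean _ _ X]eq_fun do rewrite scalar_mxE.
have b i j : bmeas D (fun y : borel W => gam y i j * l (delta_mx i j)).
  by under eq_fun do rewrite mulrC; apply: bmeasZ; exact: section_bmeas.
rewrite mean_sum //; last by move=> i; apply: bmeas_sum.
rewrite scalar_mxE; apply: eq_bigr => i _; rewrite mean_sum //.
apply: eq_bigr => j _; rewrite mxE mulrC -meanZ //; last exact: section_bmeas.
by apply: eq_mean => y _; rewrite mulrC.
Qed.

Lemma vmean_fixed (gam : W -> V) (l : {scalar V}) (k : {scalar W}) :
  borel_sections g X gam -> (forall M, l M = k (g M)) ->
  l (vmean gam) = mean mu D (fun y : borel W => k y).
Proof.
move=> sg lk; rewrite scalar_vmean //; apply: eq_mean => y Dy.
by rewrite lk; have [_ _ ->] := sg.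
Qed.

Lemma continuous_section (gam : W -> V) : continuous gam ->
  (forall y, D y -> X (gam y)) -> (forall y, D y -> g (gam y) = y) ->
  borel_sections g X gam.
Proof.
move=> cg gX gE; split => //; last by move=> _ [y Dy <-]; exact: gX.
by apply: measurable_funTS; exact: continuous_mx_borel.
Qed.

(** The pointwise combination of two measurable sections is measurable, by
[measurable_mx]. *)
Lemma fiber_convex : convex X -> convex (fiber mu g X).
Proof.
move=> cX m1 m2 t /fiberP[g1 s1 ->] /fiberP[g2 s2 ->] t01; apply/fiberP.
exists (fun y => (1 - t) *: g1 y + t *: g2 y); last first.
  apply/matrixP => i j; rewrite !mxE; symmetry.
  have b1 := section_bmeas s1 i j; have b2 := section_bmeas s2 i j.
  rewrite -meanZ // -meanZ // -meanD //; try exact: bmeasZ.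
  by apply: eq_mean => y _; rewrite !mxE.
have b1 := section_bmeas s1; have b2 := section_bmeas s2.
move: s1 s2 => [_ X1 E1] [_ X2 E2]; split.
- apply: measurable_mx => i j.
  have [+ _] := bmeasD (bmeasZ (1 - t) (b1 i j)) (bmeasZ t (b2 i j)).
  by congr measurable_fun; apply/funext => y; rewrite !mxE.
- by move=> _ [y Dy <-]; apply: cX => //; [apply: X1|apply: X2]; exists y.
- move=> y Dy; rewrite linearD !linearZ /= E1 // E2 //.
  by rewrite -scalerDl subrK scale1r.
Qed.

(** Affine maps commute with means; so an affine self-map of [X] over the base acts on
sections, and thus on the fiber. *)
Lemma fiber_comp (A : V) (h : {linear V -> V}) :
  (forall M, X M -> X (A + h M)) -> (forall M, X M -> g (A + h M) = g M) ->
  forall m, fiber mu g X m -> fiber mu g X (A + h m).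
Proof.
move=> hX hg m /fiberP[gam sg ->]; apply/fiberP; exists (fun y => A + h (gam y)).
  have ch : continuous (fun M : V => A + h M).
    apply: mx_continuous => i j; under eq_fun do rewrite mxE.
    apply: add_cont; first exact: cst_cont.
    have [l lE] : exists l : {scalar V}, forall M, l M = h M i j.
      by apply: scalar_of => a u v; rewrite linearP !mxE.
    by rewrite (_ : (fun M => h M i j) = l); [exact: scalar_continuous|exact/funext].
  move: sg => [mg gX gE]; split.
  - exact: (@measurable_comp _ _ _ _ _ _ setT (fun M : borel V => A + h M : borel V) D gam
      measurableT _ (continuous_mx_borel ch) mg).
  - by move=> _ [y Dy <-]; apply: hX; apply: gX; exists y.
  - by move=> y Dy; rewrite hg ?gE //; apply: gX; exists y.
apply/matrixP => i j; rewrite [LHS]mxE [RHS]mxE.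
have [l lE] : exists l : {scalar V}, forall M, l M = h M i j.
  by apply: scalar_of => a u v; rewrite linearP !mxE.
rewrite -lE scalar_vmean // -[A i j](@mean_cst _ _ _ mu D) // -meanD //; last 2 first.
- exact: bmeas_cst.
- exact: section_scalar_bmeas.
by apply: eq_mean => y _; rewrite mxE lE.
Qed.

End Fiber.

(** * Affine functions from a symmetric polygon to the unit interval *)

Section Bipyramid.
Context {R : realType}.
Local Notation R2 := 'rV[R]_2.
Local Notation aff := 'cV[R]_(1 + 2).

Definition aff2 (a b d : R) : aff :=
  col_mx a%:M (\col_i (if i == 0 then b else d)).

Lemma ev_aff2 a b d x : ev (aff2 a b d) x = a + b * x 0 0 + d * x 0 1.
Proof.
rewrite /ev aff_ofE col_mxKu col_mxKd !mxE big_ord_recl big_ord1 !mxE /= mulr1n.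
rewrite (_ : lift ord0 ord0 = 1 :> 'I_2); last exact/val_inj.
by rewrite addrA ![x _ _ * _]mulrC.
Qed.

Lemma aff2_coord (u : aff) : exists a b d, u = aff2 a b d.
Proof.
exists (usubmx u 0 0), (dsubmx u 0 0), (dsubmx u 1 0).
rewrite -[LHS]vsubmxK; congr col_mx; first exact: mx11_scalar.
apply/colP => i; rewrite mxE; case: eqP => [->//|i0].
by congr (dsubmx u _ 0); case: i i0 => [[|[|k]]] hi // i0; [case: i0|]; exact/val_inj.
Qed.

Definition const_aff (a : R) : aff := aff2 a 0 0.

Lemma ev_const_aff a x : ev (const_aff a) x = a.
Proof. by rewrite ev_aff2 !mul0r !addr0. Qed.

Definition cross (x y : R2) : R := x 0 0 * y 0 1 - x 0 1 * y 0 0.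

Lemma rV2P (x y : R2) : x 0 0 = y 0 0 -> x 0 1 = y 0 1 -> x = y.
Proof.
move=> h0 h1; apply/rowP; case=> [[|[|k]]] hi //.
- by rewrite (_ : Ordinal hi = 0) //; exact/val_inj.
- by rewrite (_ : Ordinal hi = 1) //; exact/val_inj.
Qed.

(** Barycentric coordinates for the triangle with vertices [v], [w], [e], where the
coordinate of [e] is given as [s]. *)
Lemma barycentric (s : aff) v w e : v != w -> ev s v = 0 -> ev s w = 0 -> ev s e = 1 ->
  exists lv lw : aff, forall u : aff,
    u = ev u v *: lv + ev u w *: lw + ev u e *: s.
Proof.
move=> vw sv sw se.
have [a [b [d sE]]] := aff2_coord s.
rewrite sE !ev_aff2 in sv sw se.
pose d0 := w 0 0 - v 0 0; pose d1 := w 0 1 - v 0 1.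
pose e0 := e 0 0 - v 0 0; pose e1 := e 0 1 - v 0 1.
have h1 : b * d0 + d * d1 = 0 by move: sv sw; rewrite /d0 /d1; lra.
have h2 : b * e0 + d * e1 = 1 by move: sv se; rewrite /e0 /e1; lra.
have cr : d0 * e1 - d1 * e0 != 0.
  apply/eqP => cr0; move/eqP: vw; apply.
  apply: rV2P; apply/eqP; rewrite eq_sym -subr_eq0; apply/eqP.
    rewrite -/d0 -[d0]mulr1 -h2.
    transitivity ((b * d0 + d * d1) * e0 + d * (d0 * e1 - d1 * e0)); first by ring.
    by rewrite h1 cr0; ring.
  rewrite -/d1 -[d1]mulr1 -h2.
  transitivity ((b * d0 + d * d1) * e1 - b * (d0 * e1 - d1 * e0)); first by ring.
  by rewrite h1 cr0; ring.
pose k := (d0 * e1 - d1 * e0)^-1.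
pose lw := aff2 (k * (v 0 1 * e0 - v 0 0 * e1)) (k * e1) (- k * e0).
exists (const_aff 1 - lw - s), lw => u.
have kE : k * (d0 * e1 - d1 * e0) = 1 by rewrite mulVf.
have lv0 : ev lw v = 0 by rewrite ev_aff2; ring.
have lw1 : ev lw w = 1 by rewrite ev_aff2 -kE /d0 /d1; ring.
have le0 : ev lw e = 0 by rewrite ev_aff2 /e0 /e1; ring.
apply/eqP; rewrite -subr_eq0; apply/eqP.
set z := u - _.
have [zv zw ze] : [/\ ev z v = 0, ev z w = 0 & ev z e = 0].
  by split; rewrite /z !(evD, evZ, evN) ev_const_aff ?lv0 ?lw1 ?le0 sE !ev_aff2 ?sv ?sw ?se; ring.
move: z zv zw ze => z; have [a' [b' [d' ->]]] := aff2_coord z; rewrite !ev_aff2 => zv zw ze.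
have h1' : b' * d0 + d' * d1 = 0 by move: zv zw; rewrite /d0 /d1; lra.
have h2' : b' * e0 + d' * e1 = 0 by move: zv ze; rewrite /e0 /e1; lra.
have b0 : b' = 0.
  rewrite -[b']mulr1 -kE; transitivity (k * ((b' * d0 + d' * d1) * e1 - (b' * e0 + d' * e1) * d1)).
    by ring.
  by rewrite h1' h2'; ring.
have d0' : d' = 0.
  rewrite -[d']mulr1 -kE; transitivity (k * ((b' * e0 + d' * e1) * d0 - (b' * d0 + d' * d1) * e0)).
    by ring.
  by rewrite h1' h2'; ring.
have a0 : a' = 0 by move: zv; rewrite b0 d0' !mul0r !addr0.
rewrite a0 b0 d0'; apply: (@ev_inj _ _ setT); last by move=> x _; rewrite ev_const_aff ev0.
by apply/seteqP; split => // x _; exact: sub_aff_hull.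
Qed.

Section Polygon.
Context (Q : set R2) (S : seq R2) (c : R2) (r : R).
Hypothesis QS : Q = conv_hull [set` S].
Hypothesis S_sym : forall x, x \in S -> c *+ 2 - x \in S.
Hypothesis r_gt0 : 0 < r.
Hypothesis ball_Q : ball c r `<=` Q.

Local Notation refl x := (c *+ 2 - x).

Lemma S_Q x : x \in S -> Q x.
Proof. by move=> xS; rewrite QS; exact: sub_conv_hull. Qed.

Lemma reflK x : refl (refl x) = x.
Proof. by rewrite opprB addrC subrK. Qed.

Lemma ev_refl (u : aff) x : ev u (refl x) = ev u c *+ 2 - ev u x.
Proof.
rewrite (_ : refl x = 2 *: c + (- 1) *: x); last by rewrite scaler_nat scaleN1r.
by rewrite ev_comb ?mulN1r ?mulr_natl //; ring.
Qed.

Lemma Q_aff_hull : aff_hull Q = setT.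
Proof. exact: ball_aff_hull r_gt0 ball_Q. Qed.

Lemma Q_center : Q c.
Proof. by apply: ball_Q; exact: ballxx. Qed.

Lemma ev_ge (u : aff) a : (forall x, x \in S -> a <= ev u x) ->
  forall x, Q x -> a <= ev u x.
Proof.
move=> h x; rewrite QS; apply: (@conv_hull_min _ _ _ [set x | a <= ev u x]) => [|y]; last exact: h.
by move=> y z t /= ay az /andP[t0 t1]; rewrite ev_comb ?subrK //; move: ay az t0 t1; nra.
Qed.

Lemma Q_sym x : Q x -> Q (refl x).
Proof.
rewrite {1}QS; apply: (@conv_hull_min _ _ _ [set x | Q (refl x)]) => [y z t /= Qy Qz t01|y yS].
  have := convex_conv_hull (A := [set` S]); rewrite -QS => /(_ _ _ _ Qy Qz t01).
  congr Q; apply/rowP => i; rewrite !mxE; ring.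
by apply: S_Q; exact: S_sym.
Qed.

Lemma ev_eq0 (u : aff) : (forall x, x \in S -> ev u x = 0) -> u = const_aff 0.
Proof.
move=> u0; apply: (ev_inj Q_aff_hull) => x Qx; rewrite ev_const_aff; apply/eqP; rewrite eq_le.
rewrite (ev_ge _ Qx) => [|y yS]; last by rewrite u0.
rewrite andbT -oppr_ge0 -evN (ev_ge _ Qx) // => y yS.
by rewrite evN u0 // oppr0.
Qed.

(** [Hom(Q, [0, 1])]. *)
Definition unit_fun (s : aff) := forall x, Q x -> 0 <= ev s x <= 1.

(** The upper bound is the lower bound at the reflected point. *)
Lemma unit_fun_ge0 s : ev s c = 2^-1 -> (forall x, x \in S -> 0 <= ev s x) -> unit_fun s.
Proof.
move=> sc s0 x Qx; rewrite (ev_ge s0) //=.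
have := ev_ge s0 (Q_sym Qx); rewrite ev_refl sc mulr2n; lra.
Qed.

(** The functions in [Hom(Q, [0, 1])] that vanish on one edge of [Q] and are equal to
[1] on the opposite one; the first edge is given by two points of [S] on it. *)
Definition edge_fun (s : aff) (p : R2 * R2) :=
  [/\ [/\ p.1 \in S, p.2 \in S & p.1 != p.2],
      ev s p.1 = 0, ev s p.2 = 0, ev s (refl p.1) = 1 & unit_fun s].

Lemma edge_fun_center s p : edge_fun s p -> ev s c = 2^-1.
Proof. by case=> _ s1 _; rewrite ev_refl s1 mulr2n => ? _; lra. Qed.

Lemma edge_fun_refl s p x : edge_fun s p -> ev s (refl x) = 1 - ev s x.
Proof. by move=> /edge_fun_center sc; rewrite ev_refl sc mulr2n; lra. Qed.

Lemma edge_fun_inj s s' p : edge_fun s p -> edge_fun s' p -> s = s'.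
Proof.
move=> [[_ _ pp] s1 s2 s3 _] [_ t1 t2 t3 _].
have [lv [lw h]] := barycentric pp s1 s2 s3.
by rewrite (h s) (h s') s1 s2 s3 t1 t2 t3.
Qed.

Lemma edge_fun_compl s p : edge_fun s p -> edge_fun (const_aff 1 - s) (refl p.1, refl p.2).
Proof.
move=> sp; have sr x := edge_fun_refl x sp; move: sp => [[p1 p2 pp] s1 s2 s3 s01]; split => /=.
- split; [exact: S_sym|exact: S_sym|].
  by apply: contra_neq pp => /(congr1 (fun x => refl x)); rewrite !reflK.
- by rewrite evB ev_const_aff sr s1; ring.
- by rewrite evB ev_const_aff sr s2; ring.
- by rewrite reflK evB ev_const_aff s1 subr0.
- by move=> x /s01; rewrite evB ev_const_aff => /andP[? ?]; apply/andP; split; lra.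
Qed.

Lemma seq_argmin (T : eqType) (f : T -> R) (s : seq T) x0 : x0 \in s ->
  exists2 x, x \in s & forall y, y \in s -> f x <= f y.
Proof.
elim: s x0 => // x s IHs x0 _; case: s IHs => [_|y s /(_ y (mem_head _ _)) [z zs zmin]].
  by exists x; rewrite ?mem_head // => y; rewrite inE => /eqP ->.
have [xz|zx] := leP (f x) (f z).
  exists x; first exact: mem_head.
  by move=> t; rewrite inE => /orP[/eqP ->//|/zmin]; exact: le_trans.
exists z; first by rewrite inE zs orbT.
by move=> t; rewrite inE => /orP[/eqP ->|/zmin//]; exact: ltW.
Qed.

Lemma bigmin_seq_le (T : eqType) (s : seq T) (P : pred T) (F : T -> R) x0 x :
  x \in s -> P x -> \big[Num.min/x0]_(y <- s | P y) F y <= F x.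
Proof.
elim: s => // y s IHs; rewrite inE big_cons => /orP[/eqP <- Px|xs Px].
  by rewrite Px ge_min lexx.
by case: ifP => _; rewrite ?ge_min IHs ?orbT.
Qed.

Lemma S_neq0 : exists x, x \in S.
Proof.
have := Q_center; rewrite QS => -[[|k] [a [w [Sa _ w1 _]]]]; last by exists (a ord0); exact: Sa.
by move: w1; rewrite big_ord0 => /esym/eqP; rewrite oner_eq0.
Qed.

(** Rotate the supporting line orthogonal to [p - c] at a point [p] of [S] farthest
from [c], until it meets another point of [S]. *)
Lemma edge_fun_exists : exists s p, edge_fun s p.
Proof.
have [x0 x0S] := S_neq0.
have [p pS pmax] := seq_argmin (fun x => - dot (x - c) (x - c)) x0S.
have {}pmax x : x \in S -> dot (x - c) (x - c) <= dot (p - c) (p - c).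
  by move=> /pmax; rewrite lerN2.
set P2 := dot (p - c) (p - c) in pmax.
have l0le x : x \in S -> dot (p - c) (x - c) <= P2.
  move=> /pmax; have := dot_ge0 ((p - c) - 1 *: (x - c)); rewrite dot_line -/P2; lra.
(* [rot] is the linear form [cross (p - c)], centred at [c]; adding a multiple of it to
   [dot (p - c)] rotates the supporting line around [p]. *)
pose rot := aff2 (c 0 0 * (p - c) 0 1 - c 0 1 * (p - c) 0 0) (- (p - c) 0 1) ((p - c) 0 0).
have rotE x : ev rot x = cross (p - c) (x - c).
  by rewrite ev_aff2 /cross !mxE; ring.
have rotc : ev rot c = 0 by rewrite rotE /cross subrr !mxE; ring.
have P2_gt0 : 0 < P2.
  rewrite lt_neqAle dot_ge0 andbT; apply/eqP => P20.
  have : aff2 (- c 0 0) 1 0 = const_aff 0.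
    apply: ev_eq0 => x /pmax; rewrite -P20 => xle.
    have /dot_eq0/rowP/(_ 0) : dot (x - c) (x - c) = 0 by apply/eqP; rewrite eq_le xle dot_ge0.
    by rewrite ev_aff2 !mxE; lra.
  move=> /(congr1 (fun u => ev u (c + const_mx 1))); rewrite ev_const_aff ev_aff2 !mxE.
  by move/eqP; rewrite (_ : _ + _ = 1) ?oner_eq0 //; ring.
(* By symmetry [rot] would otherwise vanish on [S], so everywhere. *)
have [y yS y0] : exists2 y, y \in S & 0 < ev rot y.
  apply: contrapT => none.
  have le0 x : x \in S -> ev rot x <= 0.
    by move=> xS; rewrite leNgt; apply/negP => x_gt0; apply: none; exists x.
  have : rot = const_aff 0.
    apply: ev_eq0 => x xS; have := le0 _ xS; have := le0 _ (S_sym xS).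
    by rewrite ev_refl rotc mulr2n; lra.
  move=> /(congr1 (fun u => ev u (c + \row_i (if i == 0 then - (p - c) 0 1 else (p - c) 0 0)))).
  rewrite ev_const_aff rotE (addrC c) addrK => E.
  have E2 : cross (p - c) (\row_i (if i == 0 then - (p - c) 0 1 else (p - c) 0 0)) = P2.
    rewrite /cross /P2 /dot big_ord_recl big_ord1 ![(\row__ _) _ _]mxE /=.
    by rewrite (_ : lift ord0 ord0 = 1 :> 'I_2); [ring|exact/val_inj].
  by move: P2_gt0; rewrite -E2 E ltxx.
pose T := [seq x <- S | 0 < ev rot x].
have yT : y \in T by rewrite mem_filter y0.
have [z zT zmin] := seq_argmin (fun x => (P2 - dot (p - c) (x - c)) / ev rot x) yT.
have := zT; rewrite mem_filter => /andP[z0 zS].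
set tau := (P2 - dot (p - c) (z - c)) / ev rot z in zmin.
have tau0 : 0 <= tau by rewrite divr_ge0 ?subr_ge0 ?l0le // ltW.
have key x : x \in S -> dot (p - c) (x - c) + tau * ev rot x <= P2.
  move=> xS; have [x1|x1] := ltP 0 (ev rot x).
    by rewrite -lerBrDl -ler_pdivlMr // zmin // mem_filter x1.
  by have := l0le _ xS; move: tau0 x1; nra.
have keyz : dot (p - c) (z - c) + tau * ev rot z = P2.
  by rewrite divfK ?gt_eqF // addrC subrK.
have keyp : dot (p - c) (p - c) + tau * ev rot p = P2.
  by rewrite rotE /cross -/P2; ring.
have [l lE] := dot_scalar (p - c).
have [d dE] := ev_exists (- dot (p - c) c) l.
pose s := const_aff 2^-1 - (2 * P2)^-1 *: (d + tau *: rot).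
have sE x : ev s x = 2^-1 - (2 * P2)^-1 * (dot (p - c) (x - c) + tau * ev rot x).
  by rewrite /s evB ev_const_aff !(evD, evZ) dE lE (dotDr _ x) dotNr; ring.
have P2n : P2 != 0 by rewrite gt_eqF.
have sc : ev s c = 2^-1.
  by rewrite sE rotc subrr -(scale0r c) dotZr; ring.
have s0 x : x \in S -> 0 <= ev s x.
  move=> /key; rewrite sE subr_ge0 ler_pdivrMl ?mulr_gt0 //; congr (_ <= _).
  by rewrite mulrAC divff // mul1r.
have sz x : dot (p - c) (x - c) + tau * ev rot x = P2 -> ev s x = 0.
  by rewrite sE => ->; field.
exists s, (p, z); split => /=.
- split => //; apply: contraTneq z0 => <-; rewrite rotE /cross -leNgt.
  by rewrite le_eqVlt; apply/orP; left; apply/eqP; ring.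
- exact: sz.
- exact: sz.
- by rewrite ev_refl sc sz // mulr2n; field.
- exact: unit_fun_ge0.
Qed.

(** Such an [s] is the midpoint of [s + d] and [s - d]. *)
Lemma extreme_perturb (s d : aff) : extreme unit_fun s ->
  unit_fun (s + d) -> unit_fun (s - d) -> d = 0.
Proof.
move=> [_ se] sp sm; have : s + d = s.
  by apply: (se _ (s - d)) => //; apply/matrixP => i j; rewrite !mxE; field.
by move=> /(congr1 (fun u => u - s)); rewrite subrr addrAC subrr add0r.
Qed.

(** If [s] stays away from [1], it can be scaled both up and down; hence an extreme [s]
other than the two constants takes both values [0] and [1], and its zero set contains
an edge, since it could otherwise be rotated around its unique zero. *)
Lemma extreme_unit_fun s : extreme unit_fun s ->
  [\/ s = const_aff 0, s = const_aff 1 | exists p, edge_fun s p].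
Proof.
move=> es; have [s01 _] := es.
have shrink u : extreme unit_fun u ->
    (exists2 M, M < 1 & forall x, Q x -> ev u x <= M) -> u = const_aff 0.
  move=> eu [M M1 uM]; have [u01 _] := eu.
  have M0 : 0 <= M by apply: le_trans (uM _ Q_center); have /andP[] := u01 _ Q_center.
  have : (1 - M) *: u = 0.
    apply: extreme_perturb eu _ _ => x Qx; have /andP[u0 u1] := u01 _ Qx; have := uM _ Qx.
      by rewrite evD evZ => uxM; apply/andP; split; nra.
    by rewrite evB evZ => uxM; apply/andP; split; nra.
  move/eqP; rewrite scaler_eq0 subr_eq0 gt_eqF //= => /eqP ->.
  by apply: (ev_inj Q_aff_hull) => x _; rewrite ev_const_aff ev0.
have [x0 x0S] := S_neq0.
have [v vS vmin] := seq_argmin (ev s) x0S.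
have Qmin : forall x, Q x -> ev s v <= ev s x := ev_ge vmin.
have Qmax x : Q x -> ev s x <= ev s (refl v).
  by move=> /Q_sym/Qmin; rewrite !ev_refl mulr2n; lra.
have Qv := S_Q vS.
have [s1|s1] := ltP (ev s (refl v)) 1.
  by constructor 1; apply: shrink => //; exists (ev s (refl v)).
have [s0|s0] := ltP 0 (ev s v).
  constructor 2; have : const_aff 1 - s = const_aff 0.
    apply: shrink.
      split=> [x /s01|y z y01 z01 E].
        by rewrite evB ev_const_aff => /andP[? ?]; apply/andP; split; lra.
      have h (u : aff) : unit_fun u -> unit_fun (const_aff 1 - u).
        by move=> u01 x /u01; rewrite evB ev_const_aff => /andP[? ?]; apply/andP; split; lra.
      have ys : const_aff 1 - y = s.
        apply: (es.2 _ (const_aff 1 - z)); [exact: h|exact: h|].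
        by rewrite -[s](subKr (const_aff 1)) E; apply/matrixP => i j; rewrite !mxE; field.
      by rewrite -ys subKr.
    by exists (1 - ev s v); [rewrite ltrBlDr ltrDl|move=> x /Qmin; rewrite evB ev_const_aff; lra].
  move/eqP; rewrite subr_eq => /eqP ->; apply: (ev_inj Q_aff_hull) => x _.
  by rewrite evD !ev_const_aff add0r.
have /andP[sv0 _] := s01 _ Qv; have /andP[_ sv1] := s01 _ (Q_sym Qv).
have {sv0} sv : ev s v = 0 by apply/eqP; rewrite eq_le s0.
have {sv1} srv : ev s (refl v) = 1 by apply/eqP; rewrite eq_le s1 sv1.
have sc : ev s c = 2^-1 by move: srv; rewrite ev_refl sv mulr2n; lra.
constructor 3; have [[w [wS vw sw]]|alone] := pselect (exists w, [/\ w \in S, v != w & ev s w = 0]).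
  by exists (v, w).
exfalso.
have spos w : w \in S -> w != v -> 0 < ev s w.
  move=> wS wv; have /andP[sw0 _] := s01 _ (S_Q wS).
  rewrite lt_neqAle sw0 andbT eq_sym; apply/eqP => sw; apply: alone; exists w.
  by rewrite eq_sym.
(* [phi] vanishes on the line through [c] and [v]; adding a small multiple of it to [s]
   keeps the value [1 / 2] at [c] and the zero at [v]. *)
pose phi := aff2 (c 0 0 * (v - c) 0 1 - c 0 1 * (v - c) 0 0) (- (v - c) 0 1) ((v - c) 0 0).
have phiE x : ev phi x = cross (v - c) (x - c) by rewrite ev_aff2 /cross !mxE; ring.
have phic : ev phi c = 0 by rewrite phiE /cross subrr !mxE; ring.
have phiv : ev phi v = 0 by rewrite phiE /cross; ring.
pose e := \big[Num.min/1]_(w <- S | w != v) (ev s w / (`|ev phi w| + 1)).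
have norm1 w : 0 < `|ev phi w| + 1 by rewrite ltr_wpDl.
have e0 : 0 < e.
  rewrite /e big_seq_cond; elim/big_rec : _ => // w x /andP[wS wv] x0'.
  by rewrite lt_min x0' divr_gt0 // spos.
have ele w : w \in S -> e * `|ev phi w| <= ev s w.
  move=> wS; have [->|wv] := eqVneq w v; first by rewrite phiv normr0 mulr0 sv.
  have : e <= ev s w / (`|ev phi w| + 1) by apply: bigmin_seq_le.
  rewrite ler_pdivlMr // mulrDr mulr1; apply: le_trans; by rewrite lerDl ltW.
have : e *: phi = 0.
  apply: (extreme_perturb es); apply: unit_fun_ge0 => [|w wS].
  - by rewrite evD evZ phic mulr0 addr0.
  - rewrite evD evZ; have := ele _ wS; have := ler_norm (- ev phi w); rewrite normrN; move: e0; nra.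
  - by rewrite evB evZ phic mulr0 subr0.
  - rewrite evB evZ; have := ele _ wS; have := ler_norm (ev phi w); move: e0; nra.
move/eqP; rewrite scaler_eq0 gt_eqF //= => /eqP phi0.
have vc : v = c.
  have h a b : ev phi (c + \row_i (if i == 0 then a else b)) = (v - c) 0 0 * b - (v - c) 0 1 * a.
    by rewrite phiE (addrC c) addrK /cross ![(\row__ _) _ _]mxE.
  have evphi0 x : ev phi x = 0 by rewrite phi0 ev0.
  apply: rV2P; apply/eqP; rewrite -subr_eq0; apply/eqP.
    by have := h 0 1; rewrite evphi0 !mxE; lra.
  by have := h (- 1) 0; rewrite evphi0 !mxE; lra.
by move: sc; rewrite -vc sv => /eqP; rewrite eq_sym invr_eq0 pnatr_eq0.
Qed.

(** An edge function is determined by the two points of [S], so there are finitely many. *)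
Lemma edge_fun_seq : exists es : seq aff, uniq es /\
  forall s, s \in es <-> exists p, edge_fun s p.
Proof.
pose f p := xget (const_aff 0) [set s | edge_fun s p].
exists [seq s <- undup [seq f (x, y) | x <- S, y <- S] | `[< exists p, edge_fun s p >]].
split=> [|s]; first exact: filter_uniq (undup_uniq _).
rewrite mem_filter mem_undup; split=> [/andP[/asboolP]//|[p sp]].
apply/andP; split; first by apply/asboolP; exists p.
have [[p1 p2 _] _ _ _ _] := sp.
have -> : s = f (p.1, p.2).
  rewrite /f -surjective_pairing; case: xgetP => [t _ tp|/(_ s)] //.
  exact: edge_fun_inj sp tp.
exact: allpairs_f.
Qed.

End Polygon.
End Bipyramid.

(** * The largest multiple of an edge function below an affine function *)

Section Slopes.
Context {R : realType}.
Local Notation R2 := 'rV[R]_2.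
Local Notation aff := 'cV[R]_(1 + 2).
Context (Q : set R2) (S : seq R2) (c : R2) (r : R).
Hypothesis QS : Q = conv_hull [set` S].
Hypothesis S_sym : forall x, x \in S -> c *+ 2 - x \in S.
Hypothesis r_gt0 : 0 < r.
Hypothesis ball_Q : ball c r `<=` Q.
Local Notation refl x := (c *+ 2 - x).
Local Notation unit_fun := (unit_fun Q).
Local Notation edge_fun := (edge_fun Q S c).

(** The largest [t] such that [t * s <= g] on [Q]. The default value [2 * g c] of the
minimum is, for nonnegative [g], at least the quotient at the points where [s] is [1]. *)
Definition slope (s g : aff) : R :=
  \big[Num.min/ev g c *+ 2]_(x <- S | 0 < ev s x) (ev g x / ev s x).

Lemma slope_le s g : unit_fun s -> (forall x, Q x -> 0 <= ev g x) ->
  forall x, Q x -> slope s g * ev s x <= ev g x.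
Proof.
move=> s01 g0 x Qx; rewrite -subr_ge0 -evZ -evB; apply: (ev_ge QS) Qx => y yS.
have Qy := S_Q QS yS; rewrite evB evZ subr_ge0.
have /andP[+ _] := s01 _ Qy; rewrite le_eqVlt => /orP[/eqP <-|sy].
  by rewrite mulr0 g0.
by rewrite -ler_pdivlMr //; apply: bigmin_seq_le.
Qed.

Lemma slope_ge s p g t : edge_fun s p -> (forall x, Q x -> 0 <= ev g x) ->
  (forall x, x \in S -> t * ev s x <= ev g x) -> t <= slope s g.
Proof.
move=> [[p1 _ _] _ _ se _] g0 h; rewrite /slope big_seq_cond.
apply: le_bigmin => [|x /andP[xS sx]]; last by rewrite ler_pdivlMr // h.
apply: (le_trans (y := ev g (refl p.1))).
  by have := h _ (S_sym p1); rewrite se mulr1.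
by rewrite ev_refl gerBl g0 //; exact: (S_Q QS).
Qed.

Lemma slope_ge_cst s p g m : edge_fun s p -> 0 <= m -> (forall x, Q x -> m <= ev g x) ->
  m <= slope s g.
Proof.
move=> sp m0 gm; apply: (slope_ge sp) => [x /gm|x xS]; first exact: le_trans.
have Qx := S_Q QS xS; apply: le_trans (gm _ Qx).
by have [_ _ _ _ /(_ _ Qx)/andP[_ ?]] := sp; rewrite ler_piMr.
Qed.

Lemma slope_le_one s p g x : edge_fun s p -> (forall x, Q x -> 0 <= ev g x) ->
  Q x -> ev s x = 1 -> slope s g <= ev g x.
Proof.
move=> [_ _ _ _ s01] g0 Qx s1.
by have := slope_le s01 g0 Qx; rewrite s1 mulr1.
Qed.

Lemma slope_continuous (T : topologicalType) (g : T -> aff) s :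
  (forall x, continuous (fun t => ev (g t) x)) -> continuous (fun t => slope s (g t)).
Proof.
move=> cg; rewrite /slope; elim: S => [|x l IHl].
  under eq_fun do rewrite big_nil mulr2n.
  by apply: add_cont; exact: cg.
under eq_fun do rewrite big_cons; case: (0 < ev s x) => //.
apply: min_cont => //; apply: mul_cont; [exact: cg|exact: cst_cont].
Qed.

(** The function [u] differs from [ev u e * s] by its values at [v] and [w] times
barycentric coordinates. So if [u <= g], then [ev u e * s] exceeds [g] by at most a
multiple of [ev u v + ev u w]. *)
Lemma slope_exposes s p (m M : R) : edge_fun s p -> 0 < m ->
  exists N : R, forall g u : aff, (forall x, Q x -> m <= ev g x <= M) ->
    (forall x, Q x -> 0 <= ev u x <= ev g x) ->
    ev u (refl p.1) <= slope s g + N * (ev u p.1 + ev u p.2).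
Proof.
move=> sp m0; have [[p1 p2 pp] s1 s2 s3 s01] := sp.
have [lv [lw bary]] := barycentric pp s1 s2 s3.
pose C := \sum_(x <- S) (`|ev lv x| + `|ev lw x|).
have C0 : 0 <= C by apply: sumr_ge0 => x _; exact: addr_ge0.
have CS x : x \in S -> `|ev lv x| + `|ev lw x| <= C.
  move=> xS; rewrite /C (big_rem x xS) /= lerDl; apply: sumr_ge0 => y _.
  exact: addr_ge0.
exists (M * (C / m)) => g u gmM u01.
have Qe : Q (refl p.1) by apply: (S_Q QS); exact: S_sym.
have g0 x : Q x -> 0 <= ev g x by move=> /gmM /andP[+ _]; apply: le_trans; exact: ltW.
have [/andP[v0 _] /andP[w0 _]] := (u01 _ (S_Q QS p1), u01 _ (S_Q QS p2)).
have /andP[e0 _] := u01 _ Qe.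
set a := ev u p.1 in v0 *; set b := ev u p.2 in w0 *; set t := ev u (refl p.1) in e0 *.
(* [C * (a + b)] bounds the excess of [t * s] over [g], and is at most [k * g]. *)
pose k := C / m * (a + b).
have Cm : 0 <= C / m by rewrite divr_ge0 // ltW.
have k0 : 0 <= k by rewrite mulr_ge0 // addr_ge0.
have k1 : 0 < 1 + k by rewrite ltr_wpDr.
have tk : t / (1 + k) <= slope s g.
  apply: (slope_ge sp) => // x xS; have Qx := S_Q QS xS.
  rewrite mulrAC ler_pdivrMr //.
  have /andP[mg _] := gmM _ Qx.
  have kg : C * (a + b) <= k * ev g x.
    have -> : C * (a + b) = k * m by rewrite /k; field; exact: lt0r_neq0.
    by rewrite ler_wpM2l.
  have /andP[_ ug] := u01 _ Qx.
  have := bary u => /(congr1 (fun u => ev u x)); rewrite !evD !evZ -/a -/b -/t => uE.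
  have la : - (a * ev lv x) <= a * C.
    rewrite -mulrN ler_wpM2l // (le_trans (ler_norm _)) // normrN.
    by apply: le_trans (CS _ xS); rewrite lerDl.
  have lb : - (b * ev lw x) <= b * C.
    rewrite -mulrN ler_wpM2l // (le_trans (ler_norm _)) // normrN.
    by apply: le_trans (CS _ xS); rewrite lerDr.
  move: uE ug la lb kg; lra.
have sM : slope s g <= M.
  by apply: le_trans (slope_le_one sp g0 Qe s3) _; have /andP[] := gmM _ Qe.
rewrite ler_pdivrMr // in tk; apply: (le_trans tk).
by rewrite mulrDr mulr1 lerD2l -mulrA -/k ler_wpM2r.
Qed.

End Slopes.

(** * Sets of affine maps *)

Section HomSets.
Context {R : realType}.

Definition comp_aff n m k (eta : 'M[R]_(1 + m, k)) (alpha : 'M[R]_(1 + n, m)) :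
  'M[R]_(1 + n, k) := alpha *m dsubmx eta + col_mx (usubmx eta) 0.

Lemma comp_affE n m k (eta : 'M[R]_(1 + m, k)) (alpha : 'M[R]_(1 + n, m)) x :
  aff_of (comp_aff eta alpha) x = aff_of eta (aff_of alpha x).
Proof.
rewrite [RHS]aff_ofE /aff_of /comp_aff mulmxDr mulmxA.
by rewrite (mul_row_col 1%:M x) mul1mx mulmx0 addr0 addrC.
Qed.

Lemma ev_comp n m (eta : 'cV[R]_(1 + m)) (alpha : 'M[R]_(1 + n, m)) x :
  ev (comp_aff eta alpha) x = ev eta (aff_of alpha x).
Proof. by rewrite /ev comp_affE. Qed.

Lemma aff_of_row n m k (M : 'M[R]_(1 + n, m + k)) x :
  aff_of M x = row_mx (aff_of (lsubmx M) x) (aff_of (rsubmx M) x).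
Proof. by rewrite /aff_of -mul_mx_row hsubmxK. Qed.

Lemma aff_of_continuous n m x : continuous (fun alpha : 'M[R]_(1 + n, m) => aff_of alpha x).
Proof. exact: (@linear_mx_continuous R (1 + n) m 1 m (mulmx (row_mx 1%:M x))). Qed.

Lemma ev_continuous n (eta : 'cV[R]_(1 + n)) : continuous (ev eta).
Proof.
rewrite /ev; under eq_fun do rewrite aff_ofE mxE.
apply: add_cont; first exact: cst_cont.
have h := @linear_mx_continuous R 1 n 1 1 (mulmxr (dsubmx eta)); move=> x.
exact: (continuous_comp (h x) (@coord_continuous _ _ _ _ _ _)).
Qed.

Lemma ev_comp_continuous n m (eta : 'cV[R]_(1 + m)) x :
  continuous (fun alpha : 'M[R]_(1 + n, m) => ev (comp_aff eta alpha) x).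
Proof.
under eq_fun do rewrite ev_comp; move=> alpha.
exact: (continuous_comp (@aff_of_continuous _ _ x alpha) (@ev_continuous _ eta _)).
Qed.

Lemma Hom_map_proj n (M : 'M[R]_(1 + n, 2 + 1)) : Hom_map proj_base M = lsubmx M.
Proof.
rewrite /Hom_map -[RHS]aff_ofK; congr mx_of_aff; apply/funext => x /=.
by rewrite aff_of_row /proj_base row_mxKl.
Qed.

Lemma Hom_convex n m (A : set 'rV[R]_n) (B : set 'rV[R]_m) : convex B -> convex (Hom_set A B).
Proof.
move=> cB M N t AM AN t01 _ [x Ax <-].
have -> : aff_of ((1 - t) *: M + t *: N) x = (1 - t) *: aff_of M x + t *: aff_of N x.
  by rewrite /aff_of mulmxDr -!scalemxAr.
by apply: cB => //; [apply: AM|apply: AN]; exists x.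
Qed.

Lemma Hom_closed n m (A : set 'rV[R]_n) (B : set 'rV[R]_m) : closed B -> closed (Hom_set A B).
Proof.
move=> cB; rewrite (_ : Hom_set A B = \bigcap_(x in A) ((fun M => aff_of M x) @^-1` B)).
  apply: closed_bigI => x Ax; apply: closed_comp => // M _; exact: aff_of_continuous.
apply/seteqP; split => [M AM x Ax|M AM _ [x Ax <-]]; last exact: AM.
by apply: AM; exists x.
Qed.

(** An affine map is determined by its values at [c] and at [c] plus small multiples of
the basis vectors, all of which are in [A]. *)
Lemma Hom_bounded n m (A : set 'rV[R]_n) (B : set 'rV[R]_m) c r :
  0 < r -> ball c r `<=` A ->
  (exists b : R, forall y, B y -> forall i j, `|y i j| <= b) ->
  exists b : R, forall M, Hom_set A B M -> forall i j, `|M i j| <= b.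
Proof.
move=> r0 cA [b Bb].
have r2 : 0 < r / 2 by rewrite divr_gt0.
pose b1 := (b + b) / (r / 2); pose b2 := b + \sum_k `|c 0 k| * b1.
exists (Num.max b1 b2) => M AM i j.
have val x : A x -> `|aff_of M x 0 j| <= b by move=> Ax; apply: Bb; apply: AM; exists x.
have Ac : A c by apply: cA; exact: ballxx.
have d k : `|dsubmx M k j| <= b1.
  have Ak : A (c + (r / 2) *: delta_mx 0 k).
    apply: cA; apply/mx_ballP => // i' j'; rewrite !mxE opprD addNKr normrN normrM.
    rewrite (gtr0_norm r2) (le_lt_trans (y := r / 2)) //; last by move: r0; lra.
    rewrite ler_piMr ?(ltW r2) //; case: (_ && _); rewrite ?normr1 ?normr0 ?ler01 //.
  rewrite ler_pdivlMr // -(gtr0_norm r2) -normrM.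
  have -> : dsubmx M k j * (r / 2) = aff_of M (c + (r / 2) *: delta_mx 0 k) 0 j - aff_of M c 0 j.
    by rewrite !aff_ofE mulmxDl -scalemxAl -rowE !mxE; ring.
  by rewrite (le_trans (ler_normB _ _)) // lerD // val.
rewrite le_max; case: (split_ordP i) => k ->; last first.
  by have := d k; rewrite mxE => ->.
have u : `|usubmx M k j| <= b2.
  rewrite ord1; have -> : usubmx M 0 j = aff_of M c 0 j - \sum_k c 0 k * dsubmx M k j.
    by rewrite aff_ofE [in RHS]mxE [X in _ + X - _]mxE addrK.
  rewrite (le_trans (ler_normB _ _)) // lerD ?val // (le_trans (ler_norm_sum _ _ _)) //.
  by apply: ler_sum => k' _; rewrite normrM ler_wpM2l.
by move: u; rewrite mxE => ->; rewrite orbT.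
Qed.

Lemma Hom_ball n m (A : set 'rV[R]_n) (B : set 'rV[R]_m) alpha rho b :
  (forall x, A x -> forall i, `|x 0 i| <= b) -> 0 < rho ->
  (forall x, A x -> ball (aff_of alpha x) rho `<=` B) ->
  exists2 e : R, 0 < e & ball alpha e `<=` Hom_set A B.
Proof.
move=> Ab rho0 aB; pose K := 1 + \sum_(i < n) `|b| + 1.
have K0 : 0 < K by rewrite ltr_wpDl // addr_ge0 // sumr_ge0.
exists (rho / K) => [|beta ab _ [x Ax <-]]; first by rewrite divr_gt0.
have {}ab := (mx_ballP _ _ (divr_gt0 rho0 K0)).1 ab.
apply: (aB _ Ax); apply/mx_ballP => // i j; rewrite ord1 !aff_ofE.
have -> : (usubmx alpha + x *m dsubmx alpha) 0 j - (usubmx beta + x *m dsubmx beta) 0 j =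
    (usubmx alpha 0 j - usubmx beta 0 j) + \sum_k x 0 k * (dsubmx alpha k j - dsubmx beta k j).
  under eq_bigr do rewrite mulrBr.
  by rewrite sumrB ![(_ + _ : 'rV_m) 0 j]mxE ![(x *m _) 0 j]mxE; ring.
apply: le_lt_trans (ler_normD _ _) _.
apply: (le_lt_trans (y := rho / K * (1 + \sum_(i < n) `|b|))); last first.
  rewrite mulrAC ltr_pdivrMr // ltr_pM2l // /K ltrDl ltr01 //.
rewrite mulrDr mulr1 lerD //.
  by rewrite !mxE; apply: ltW; exact: ab.
rewrite (le_trans (ler_norm_sum _ _ _)) // mulr_sumr; apply: ler_sum => k _.
rewrite normrM mulrC ler_pM //; last by rewrite (le_trans (Ab _ Ax k)) ?ler_norm.
by rewrite !mxE; apply: ltW; exact: ab.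
Qed.

End HomSets.

(** * The fiber of Hom(Q, P) over Hom(Q, Q) *)

Section HomFiber.
Context {R : realType}.
Local Notation R2 := 'rV[R]_2.
Local Notation R3 := 'rV[R]_(2 + 1).
Local Notation aff := 'cV[R]_(1 + 2).
Local Notation W := 'M[R]_(1 + 2, 2).
Local Notation V := 'M[R]_(1 + 2, 2 + 1).
Context (Q : set R2) (S : seq R2) (c : R2) (r : R) (P : set R3).
Context (eta0 eta1 eta2 : R).
Local Notation eta := (aff2 eta0 eta1 eta2).
Hypothesis QS : Q = conv_hull [set` S].
Hypothesis S_sym : forall x, x \in S -> c *+ 2 - x \in S.
Hypothesis r_gt0 : 0 < r.
Hypothesis ball_Q : ball c r `<=` Q.
Hypothesis P_polytope : polytope P.
Hypothesis eta_gt0 : forall x, Q x -> 0 < ev eta x.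
Hypothesis PE : forall x t, P (pt x t) <-> Q x /\ 0 <= t <= ev eta x.
Hypothesis eta_slant : 0 < eta1 ^+ 2 + eta2 ^+ 2.
Context (nu : {measure set (borel W) -> \bar R}).
Hypothesis nu_inv : translation_invariant setT nu.
Local Notation refl x := (c *+ 2 - x).
Local Notation edge_fun := (edge_fun Q S c).
Local Notation proj := (@lsubmx R (1 + 2) 2 1).
Local Notation X := (Hom_set Q P).
Local Notation D := (proj @` X : set (borel W)).
Local Notation F := (fiber nu proj X).

Let Q_poly : polytope Q. Proof. by exists S. Qed.
Let Q_cpt : compact Q := polytope_compact Q_poly.
Let Q_closed : closed Q := compact_mx_closed Q_cpt.
Let QT : aff_hull Q = setT := ball_aff_hull r_gt0 ball_Q.
Let Qc : Q c. Proof. exact: Q_center r_gt0 ball_Q. Qed.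

Lemma Hom_PE (M : V) : X M <-> Hom_set Q Q (lsubmx M) /\
  forall x, Q x -> 0 <= ev (rsubmx M) x <= ev (comp_aff eta (lsubmx M)) x.
Proof.
have E x : aff_of M x = pt (aff_of (lsubmx M) x) (ev (rsubmx M) x).
  by rewrite aff_of_row /pt /ev -mx11_scalar.
split=> [XM|[h1 h2] _ [x Qx <-]].
  have h x : Q x -> P (pt (aff_of (lsubmx M) x) (ev (rsubmx M) x)).
    by move=> Qx; rewrite -E; apply: XM; exists x.
  split=> [_ [x Qx <-]|x Qx]; first by have /PE[] := h _ Qx.
  by rewrite ev_comp; have /PE[] := h _ Qx.
rewrite E; apply/PE; split; first by apply: h1; exists x.
by rewrite -ev_comp; exact: h2.
Qed.

(** Every affine self-map of [Q] lifts to the bottom of [P]. *)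
Lemma base_HomE : D = Hom_set Q Q.
Proof.
apply/seteqP; split => [_ [M /Hom_PE[h _] <-]//|alpha h].
exists (row_mx alpha 0); last exact: row_mxKl.
apply/Hom_PE; rewrite row_mxKl row_mxKr; split => // x Qx.
rewrite ev0 lexx /= ev_comp.
by apply: ltW; apply: eta_gt0; apply: h; exists x.
Qed.

Lemma Q_bound : exists b : R, forall x, Q x -> forall i j, `|x i j| <= b.
Proof. exact: compact_mx_bounded. Qed.

Lemma X_bound : exists b : R, forall M, X M -> forall i j, `|M i j| <= b.
Proof.
apply: (Hom_bounded r_gt0 ball_Q).
exact/compact_mx_bounded/polytope_compact.
Qed.

Lemma eta_bounds : exists m M : R, 0 < m /\ forall x, Q x -> m <= ev eta x <= M.
Proof.
have [x0 x0S] := S_neq0 QS r_gt0 ball_Q.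
have [y yS ymin] := seq_argmin (ev eta) x0S.
have [z zS zmin] := seq_argmin (ev (- eta)) x0S.
exists (ev eta y), (ev eta z); split; first exact/eta_gt0/(S_Q QS).
move=> x Qx; rewrite (ev_ge QS ymin) //= -lerN2 -!evN.
exact: (ev_ge QS zmin).
Qed.

Lemma dom_measurable : measurable D.
Proof.
by rewrite base_HomE; apply: closed_borel; exact: Hom_closed.
Qed.

Lemma dom_fin : (nu D < +oo)%E.
Proof.
have [_ _ nu_cpt _] := nu_inv; apply: nu_cpt; rewrite base_HomE.
have [b Qb] := Q_bound.
have [b' Db] := Hom_bounded r_gt0 ball_Q (ex_intro _ b Qb).
apply: (subclosed_compact _ (@box_compact _ _ _ b')) => //.
exact: Hom_closed.
Qed.

(** A nearby map moves the images of the points of [Q] by less than [r / 2]. *)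
Lemma Hom_interior (alpha : W) :
  (forall x, Q x -> ball c (r / 2) (aff_of alpha x)) ->
  exists2 e : R, 0 < e & ball alpha e `<=` Hom_set Q Q.
Proof.
move=> h; have [b Qb] := Q_bound.
apply: (Hom_ball (rho := r / 2) (b := b)); first by move=> x Qx i; exact: Qb.
  by rewrite divr_gt0.
by move=> x /h hx y xy; apply: ball_Q; exact: ball_split hx xy.
Qed.

(** An affine map with values on the line through [c] in direction [d2], which takes the
value [c] at [y0] and varies in direction [d1]; see [contractionE]. *)
Definition contraction (y0 d1 d2 : R2) (k : R) : W :=
  col_mx c 0 + k *: (col_mx (- dot d1 y0)%:M d1^T *m d2).

Lemma contractionE y0 d1 d2 k y :
  aff_of (contraction y0 d1 d2 k) y = c + (k * dot d1 (y - y0)) *: d2.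
Proof.
rewrite /contraction /aff_of mulmxDr -scalemxAr mulmxA !mul_row_col !mul1mx mulmx0 addr0.
rewrite -scalerA; congr (_ + _ *: _).
rewrite [X in X *m _]mx11_scalar mul_scalar_mx; congr (_ *: _).
rewrite !mxE eqxx mulr1n dotDr dotNr addrC; congr (_ + _).
by apply: eq_bigr => i _; rewrite mxE mulrC.
Qed.

Lemma contraction_interior y0 d1 d2 : exists2 k : R, 0 < k &
  exists2 e : R, 0 < e & ball (contraction y0 d1 d2 k) e `<=` Hom_set Q Q.
Proof.
have [b Qb] := Q_bound.
pose B := \sum_i `|d1 0 i| * (`|b| + `|y0 0 i|).
have B0 : 0 <= B by apply: sumr_ge0 => i _; rewrite mulr_ge0 // addr_ge0.
pose C := \sum_i `|d2 0 i|.
have C0 : 0 <= C by exact: sumr_ge0.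
have BC : 0 < B * C + 1 by rewrite ltr_wpDl // mulr_ge0.
have [k k0 kE] : exists2 k, 0 < k & k * (B * C + 1) = r / 4.
  by exists (r / 4 / (B * C + 1)); [rewrite !divr_gt0|rewrite divfK // gt_eqF].
exists k => //.
apply: Hom_interior => y Qy; apply/mx_ballP; first by rewrite divr_gt0.
move=> i j; rewrite ord1 contractionE !mxE opprD addNKr normrN !normrM.
have dB : `|dot d1 (y - y0)| <= B.
  rewrite (le_trans (ler_norm_sum _ _ _)) //; apply: ler_sum => l _.
  rewrite normrM ler_wpM2l // !mxE (le_trans (ler_normB _ _)) // lerD //.
  by rewrite (le_trans (Qb _ Qy 0 l)) // ler_norm.
have dC : `|d2 0 j| <= C by rewrite /C (bigD1 j) //= lerDl; exact: sumr_ge0.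
rewrite (gtr0_norm k0) -mulrA.
apply: (le_lt_trans (y := k * (B * C))); first by rewrite ler_wpM2l ?ler_pM // ltW.
by move: kE k0 r_gt0; lra.
Qed.

Lemma dom_gt0 : (0 < nu D)%E.
Proof.
have [k _ [e e0 he]] := contraction_interior 0 0 0.
rewrite base_HomE; apply: (@lt_le_trans _ _ (nu (ball (contraction 0 0 0 k) e))).
  apply: translation_invariant_gt0 => //; first exact: ball_open.
  by exists (contraction 0 0 0 k); exact: ballxx.
apply: le_measure => //; rewrite inE; first by apply: open_borel; exact: ball_open.
by rewrite -base_HomE; exact: dom_measurable.
Qed.

Local Notation mean := (mean nu D).
Local Notation vmean := (vmean nu proj X).

Let F_P := @fiberP _ _ _ _ _ nu proj X.

(** The barycentre of [Hom(Q, Q)]. *)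
Definition base_mean : W := \matrix_(i, j) mean (fun alpha : borel W => (alpha : W) i j).
(** The mean of [eta \o alpha], by [ev_roof_mean]; it is the largest element of the fiber. *)
Definition roof_mean : aff := comp_aff eta base_mean.

Lemma section_lsub (gam : W -> V) : borel_sections proj X gam ->
  forall alpha, D alpha -> lsubmx (gam alpha) = alpha.
Proof. by move=> [_ _]. Qed.

(** The component of a section in the base is the identity. *)
Lemma fiber_lsub m : F m -> lsubmx m = base_mean.
Proof.
move=> /F_P[gam sg ->]; apply/matrixP => i j; rewrite !mxE.
by apply: eq_mean => alpha Da; rewrite -{2}(section_lsub sg Da) mxE.
Qed.

Lemma fiber_row m : F m -> m = row_mx base_mean (rsubmx m).
Proof. by move=> /fiber_lsub <-; rewrite hsubmxK. Qed.

Lemma ev_rsub_scalar x : exists l : {scalar V}, forall M, l M = ev (rsubmx M) x.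
Proof.
by apply: scalar_of => a u v; rewrite linearP /= evD evZ.
Qed.

Lemma section_ev_bmeas (gam : W -> V) x : borel_sections proj X gam ->
  bmeas D (fun alpha : borel W => ev (rsubmx (gam alpha)) x).
Proof.
move=> sg; have [l lE] := ev_rsub_scalar x.
have := section_scalar_bmeas X_bound l sg.
by apply: eq_bmeas => alpha _; rewrite lE.
Qed.

Lemma ev_vmean (gam : W -> V) x : borel_sections proj X gam ->
  ev (rsubmx (vmean gam)) x = mean (fun alpha : borel W => ev (rsubmx (gam alpha)) x).
Proof.
move=> sg; have [l lE] := ev_rsub_scalar x.
rewrite -lE (scalar_vmean dom_measurable dom_gt0 dom_fin X_bound) //.
by apply: eq_mean => alpha _; rewrite lE.
Qed.

Lemma continuous_bmeas (f : W -> R) (b : R) : continuous f ->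
  (forall alpha, D alpha -> `|f alpha| <= b) -> bmeas D (f : borel W -> R).
Proof.
move=> cf fb; split; last by exists b.
by apply: measurable_funTS; exact: continuous_borel.
Qed.

Lemma comp_eta_bounds : exists m M : R, 0 < m /\ forall alpha, D alpha ->
  forall x, Q x -> m <= ev (comp_aff eta alpha) x <= M.
Proof.
have [m [M [m0 h]]] := eta_bounds; exists m, M; split => // alpha Da x Qx.
by rewrite ev_comp; apply: h; move: Da; rewrite base_HomE => Da; apply: Da; exists x.
Qed.

Lemma comp_eta_ge0 alpha x : D alpha -> Q x -> 0 <= ev (comp_aff eta alpha) x.
Proof.
have [m [M [m0 h]]] := comp_eta_bounds => Da Qx.
by have /andP[+ _] := h _ Da _ Qx; apply: le_trans; exact: ltW.
Qed.

Lemma comp_eta_bmeas x : Q x ->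
  bmeas D (fun alpha : borel W => ev (comp_aff eta (alpha : W)) x).
Proof.
move=> Qx; have [m [M [m0 h]]] := comp_eta_bounds.
apply: (continuous_bmeas (b := M)); first exact: ev_comp_continuous.
move=> alpha Da; rewrite ger0_norm ?comp_eta_ge0 //.
by have /andP[] := h _ Da _ Qx.
Qed.

Lemma graph_section (f : W -> aff) : continuous f ->
  (forall alpha, D alpha -> forall x, Q x -> 0 <= ev (f alpha) x <= ev (comp_aff eta alpha) x) ->
  borel_sections proj X (fun alpha => row_mx alpha (f alpha)).
Proof.
move=> cf fD; apply: continuous_section.
- apply: mx_continuous => i j; under eq_fun do rewrite mxE.
  by case: (fintype.split j) => k; [exact: coord_continuous|
     move=> alpha; exact: (continuous_comp (cf alpha) (@coord_continuous _ _ _ _ _ _))].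
- move=> alpha Da; apply/Hom_PE; rewrite row_mxKl row_mxKr; split; first by rewrite -base_HomE.
  exact: fD.
- by move=> alpha _; exact: row_mxKl.
Qed.

Lemma zero_section : borel_sections proj X (fun alpha => row_mx alpha 0).
Proof.
apply: graph_section => [|alpha Da x Qx].
- exact: cst_continuous.
- by rewrite ev0 lexx comp_eta_ge0.
Qed.

Lemma fiber_zero : F (row_mx base_mean 0).
Proof.
have F0 : F (vmean (fun alpha => row_mx alpha 0)).
  by apply/F_P; eexists; first exact: zero_section.
have := F0; rewrite {1}(fiber_row F0); congr (F (row_mx _ _)).
apply: (ev_inj QT) => x _; rewrite ev_vmean; last exact: zero_section.
rewrite (@eq_mean _ _ _ _ _ _ (fun=> 0)); last first.
  by move=> alpha _; rewrite row_mxKr ev0.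
by rewrite (mean_cst dom_measurable dom_gt0 dom_fin) ev0.
Qed.

(** Composition with [eta] is affine, so it commutes with means. *)
Lemma ev_roof_mean x : Q x ->
  ev roof_mean x = mean (fun alpha : borel W => ev (comp_aff eta (alpha : W)) x).
Proof.
move=> Qx.
have [k kE] : exists k : {scalar W}, forall alpha, k alpha = ev (comp_aff eta alpha) x - eta0.
  apply: scalar_of => a u v; rewrite !ev_comp !ev_aff2.
  rewrite (_ : aff_of (a *: u + v) x = a *: aff_of u x + aff_of v x); last first.
    by rewrite /aff_of mulmxDr -scalemxAr.
  by rewrite !mxE; ring.
have [l lE] : exists l : {scalar V}, forall M, l M = k (lsubmx M).
  by apply: scalar_of => a u v; rewrite !linearP.
have := vmean_fixed dom_measurable dom_gt0 dom_fin X_bound zero_section lE.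
rewrite lE fiber_lsub; last by apply/F_P; eexists; first exact: zero_section.
rewrite kE => /eqP; rewrite subr_eq => /eqP ->.
rewrite -[X in _ + X](mean_cst dom_measurable dom_gt0 dom_fin).
rewrite -meanD //; try exact: dom_measurable; try exact: dom_fin.
- by apply: eq_mean => alpha _; rewrite kE subrK.
- under eq_fun do rewrite kE; apply: bmeasD; first exact: comp_eta_bmeas.
  exact: bmeas_cst.
- exact: bmeas_cst.
Qed.

(** The self-map [u |-> eta \o alpha - u] of [Hom(Q, P)] exchanges the zero section with
the section given by the roof of [P]. *)
Lemma fiber_refl m : F m -> F (row_mx base_mean (roof_mean - rsubmx m)).
Proof.
(* The linear part of this self-map is right multiplication by [N]. *)
move=> Fm; pose N : 'M[R]_(2 + 1) := block_mx 1%:M (dsubmx eta) 0 (- 1%:M).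
pose A : V := row_mx 0 (col_mx (usubmx eta) 0).
have hE M : A + mulmxr N M = row_mx (lsubmx M) (comp_aff eta (lsubmx M) - rsubmx M).
  rewrite /= -{1}[M]hsubmxK mul_row_block mulmx1 mulmx0 addr0 add_row_mx add0r.
  by rewrite mulmxN mulmx1 /comp_aff addrCA addrA.
have := @fiber_comp _ _ _ _ _ nu proj X dom_measurable dom_gt0 dom_fin X_bound
  A (mulmxr N) _ _ m Fm.
rewrite hE (fiber_lsub Fm); apply => M XM; rewrite hE /= ?row_mxKl //.
have [h1 h2] := (Hom_PE M).1 XM.
apply/Hom_PE; rewrite row_mxKl row_mxKr; split => // x /h2 /andP[? ?].
by rewrite evB; apply/andP; split; lra.
Qed.

Lemma vert_intro (K : set V) m (l : {scalar V}) : K m ->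
  (forall m', K m' -> l m' <= l m) -> (forall m', K m' -> l m' = l m -> m' = m) -> vert K m.
Proof.
move=> Km lm eqm; exists l, (l m); split => //.
apply/seteqP; split => [_ ->//|m' [Km' /= E]]; exact: eqm.
Qed.

Lemma fiber_ev_ge0 m x : F m -> Q x -> 0 <= ev (rsubmx m) x.
Proof.
move=> /F_P[gam sg ->] Qx; rewrite ev_vmean //.
rewrite -(mean_cst dom_measurable dom_gt0 dom_fin 0).
apply: (mean_le dom_measurable dom_gt0 dom_fin).
- exact: bmeas_cst.
- exact: section_ev_bmeas.
- move=> alpha Da; have [_ gX gE] := sg.
  have /Hom_PE[_ /(_ _ Qx) /andP[]//] : X (gam alpha) by apply: gX; exists alpha.
Qed.

(** A nonnegative affine function that vanishes at the centre of [Q] is zero. *)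
Lemma vert_zero : vert F (row_mx base_mean 0).
Proof.
have [l lE] : exists l : {scalar V}, forall M, l M = - ev (rsubmx M) c.
  by apply: scalar_of => a u v; rewrite linearP /= evD evZ; ring.
apply: (vert_intro (l := l)); first exact: fiber_zero.
  by move=> m Fm; rewrite !lE row_mxKr ev0 lerN2 fiber_ev_ge0.
move=> m Fm; rewrite !lE row_mxKr ev0 => /eqP; rewrite eqr_opp => /eqP mc.
rewrite (fiber_row Fm); congr row_mx; apply: (ev_inj QT) => x Qx; rewrite ev0.
apply/eqP; rewrite eq_le fiber_ev_ge0 // andbT.
have := fiber_ev_ge0 Fm (Q_sym QS S_sym Qx); rewrite ev_refl mc mulr2n; lra.
Qed.

(** The reflection of the fiber takes a supporting functional to a supporting functional. *)
Lemma vert_refl s : vert F (row_mx base_mean s) -> vert F (row_mx base_mean (roof_mean - s)).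
Proof.
move=> Vs; have Fs := vert_sub Vs; move: Vs => [l [b [lb E]]].
have ls : l (row_mx base_mean s) = b.
  by have : [set row_mx base_mean s] (row_mx base_mean s) by []; rewrite E => -[].
have [k kE] : exists k : {scalar V}, forall M, k M = l (row_mx (lsubmx M) (- rsubmx M)).
  apply: scalar_of => a u v; rewrite -linearP; congr (l _).
  by rewrite scale_row_mx add_row_mx; congr row_mx; apply/matrixP => i j; rewrite !mxE //; ring.
have lk m : F m -> k m = l (row_mx base_mean (roof_mean - rsubmx m)) - l (row_mx 0 roof_mean).
  move=> Fm; rewrite kE (fiber_lsub Fm) -linearB; congr (l _).
  by rewrite opp_row_mx add_row_mx subr0 addrAC subrr add0r.
have Frs : F (row_mx base_mean (roof_mean - s)) by have := fiber_refl Fs; rewrite row_mxKr.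
have rr u : roof_mean - (roof_mean - u) = u by rewrite opprB addrC subrK.
apply: (vert_intro (l := k)) => // m Fm; rewrite (lk _ Fm) (lk _ Frs) row_mxKr rr ls.
  by rewrite lerD2r; exact/lb/fiber_refl.
move=> /addIr kb; have : [set row_mx base_mean s] (row_mx base_mean (roof_mean - rsubmx m)).
  by rewrite E; split => //; exact: fiber_refl.
move=> /= /eq_row_mx[_ <-]; rewrite rr; exact: fiber_row.
Qed.

(** The mean of the sections [slope s * s] is [slope_mean s] times [s]. *)
Definition slope_mean (s : aff) : R :=
  mean (fun alpha : borel W => slope S c s (comp_aff eta (alpha : W))).

Section Edge.
Context (s : aff) (p : R2 * R2).
Hypothesis sp : edge_fun s p.

Let s01 : unit_fun Q s. Proof. by case: sp. Qed.

Lemma slope_bounds : exists m M : R, 0 < m /\ forall alpha, D alpha ->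
  m <= slope S c s (comp_aff eta alpha) <= M.
Proof.
have [m [M [m0 h]]] := comp_eta_bounds; exists m, M; split => // alpha Da.
have [[p1 _ _] _ _ se _] := sp.
have Qe : Q (refl p.1) by apply: (S_Q QS); exact: S_sym.
rewrite (slope_ge_cst QS S_sym sp (ltW m0)) /=; last by move=> x /(h _ Da)/andP[].
have /andP[_] := h _ Da _ Qe; apply: le_trans.
by apply: (slope_le_one QS sp) => // x; exact: comp_eta_ge0.
Qed.

Lemma slope_comp_continuous : continuous (fun alpha : W => slope S c s (comp_aff eta alpha)).
Proof. by apply: slope_continuous => x; exact: ev_comp_continuous. Qed.

Lemma slope_bmeas : bmeas D (fun alpha : borel W => slope S c s (comp_aff eta (alpha : W))).
Proof.
have [m [M [m0 h]]] := slope_bounds.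
apply: (continuous_bmeas (b := M)); first exact: slope_comp_continuous.
move=> alpha /h /andP[mt tM]; rewrite ger0_norm //.
exact: le_trans (ltW m0) mt.
Qed.

Lemma slope_mean_gt0 : 0 < slope_mean s.
Proof.
have [m [M [m0 h]]] := slope_bounds; apply: (lt_le_trans m0).
rewrite -(mean_cst dom_measurable dom_gt0 dom_fin m).
apply: (mean_le dom_measurable dom_gt0 dom_fin).
- exact: bmeas_cst.
- exact: slope_bmeas.
- by move=> alpha /h /andP[].
Qed.

Lemma slope_section :
  borel_sections proj X (fun alpha => row_mx alpha (slope S c s (comp_aff eta alpha) *: s)).
Proof.
apply: graph_section => [|alpha Da x Qx].
- apply: mx_continuous => i j; under eq_fun do rewrite mxE.
  by apply: mul_cont; [exact: slope_comp_continuous|exact: cst_cont].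
- have [m [M [m0 /(_ _ Da)/andP[mt _]]]] := slope_bounds.
  have /andP[sx _] := s01 Qx.
  rewrite evZ mulr_ge0 ?(le_trans (ltW m0) mt) //=.
  by apply: (slope_le _ QS) => // y; exact: comp_eta_ge0.
Qed.

Lemma fiber_slope : F (row_mx base_mean (slope_mean s *: s)).
Proof.
have F0 : F (vmean (fun alpha => row_mx alpha (slope S c s (comp_aff eta alpha) *: s))).
  by apply/F_P; eexists; first exact: slope_section.
have := F0; rewrite {1}(fiber_row F0); congr (F (row_mx _ _)).
apply: (ev_inj QT) => x _; rewrite ev_vmean; last exact: slope_section.
rewrite evZ mulrC -(meanZ dom_measurable dom_fin); last exact: slope_bmeas.
by apply: eq_mean => alpha _; rewrite row_mxKr evZ mulrC.
Qed.

(** The values of [eta \o alpha] stay in a compact interval of positive numbers, so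
[slope_exposes] applies with one constant [N] for all [alpha], and the inequality can
be integrated. Equality forces the mean to vanish at both points where [s] does. *)
Lemma vert_slope : vert F (row_mx base_mean (slope_mean s *: s)).
Proof.
have [[p1 p2 pp] sv sw se _] := sp.
have [m [M [m0 hm]]] := comp_eta_bounds.
have [N hN] := slope_exposes QS S_sym M sp m0.
have Qv := S_Q QS p1; have Qw := S_Q QS p2.
have [l lE] : exists l : {scalar V}, forall m, l m = ev (rsubmx m) (refl p.1) -
    N * (ev (rsubmx m) p.1 + ev (rsubmx m) p.2).
  by apply: scalar_of => a u v; rewrite linearP /= !evD !evZ; ring.
have [l' l'E] : exists l' : {scalar V}, forall m, l' m = l m -
    (ev (rsubmx m) p.1 + ev (rsubmx m) p.2).
  by apply: scalar_of => a u v; rewrite !linearP /= !evD !evZ; ring.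
have lle m' : F m' -> l m' <= slope_mean s.
  move=> /F_P[gam sg ->]; rewrite (scalar_vmean dom_measurable dom_gt0 dom_fin X_bound) //.
  apply: (mean_le dom_measurable dom_gt0 dom_fin); first exact: (section_scalar_bmeas X_bound l sg).
    exact: slope_bmeas.
  move=> alpha Da; rewrite lE lerBlDr; apply: hN; first exact: hm.
  have [_ gX _] := sg; have /Hom_PE[_] : X (gam alpha) by apply: gX; exists alpha.
  by rewrite (section_lsub sg).
have lA : l' (row_mx base_mean (slope_mean s *: s)) = slope_mean s.
  by rewrite l'E lE row_mxKr !evZ sv sw se; ring.
apply: (vert_intro (l := l')) => [|m' Fm'|m' Fm'].
- exact: fiber_slope.
- rewrite lA l'E; have := lle _ Fm'.
  have := fiber_ev_ge0 Fm' Qv; have := fiber_ev_ge0 Fm' Qw; lra.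
- rewrite lA l'E => E; have le := lle _ Fm'.
  have v0 := fiber_ev_ge0 Fm' Qv; have w0 := fiber_ev_ge0 Fm' Qw.
  have {}v0 : ev (rsubmx m') p.1 = 0 by lra.
  have {}w0 : ev (rsubmx m') p.2 = 0 by lra.
  move: E; rewrite lE v0 w0 addr0 mulr0 !subr0 => e.
  have [lv [lw bary]] := barycentric pp sv sw se.
  rewrite (fiber_row Fm'); congr row_mx.
  by rewrite (bary (rsubmx m')) v0 w0 e !scale0r !add0r.
Qed.

(** The slope for [alpha] is at most the value of [eta \o alpha] at any point where [s]
is [1]. By the symmetry of [Q] there are two such points, so one of them, [x'], differs
from [x]. As [eta] is not constant, some interior point [alpha0] of [Hom(Q, Q)] gives
[eta \o alpha0] a larger value at [x] than at [x'], and so do all [alpha] near it. *)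
Lemma slope_lt_roof x : Q x -> slope_mean s * ev s x < ev roof_mean x.
Proof.
move=> Qx; have [[p1 p2 pp] sv sw se _] := sp.
have sr := edge_fun_refl _ sp.
have [x' [Qx' sx' xx']] : exists x', [/\ Q x', ev s x' = 1 & x != x'].
  have [xe|xe] := eqVneq x (refl p.1); last first.
    by exists (refl p.1); split => //; apply: (S_Q QS); exact: S_sym.
  exists (refl p.2); split; [by apply: (S_Q QS); exact: S_sym|by rewrite sr sw subr0|].
  rewrite xe; apply: contra_neq pp => /(congr1 (fun x => refl x)).
  by rewrite !reflK.
(* [d] is the gradient of [eta] *)
pose d : R2 := \row_i (if i == 0 then eta1 else eta2).
have [k k0 [e e0 he]] := contraction_interior x' (x - x') d.
set alpha0 := contraction _ _ _ _ in he.
pose del alpha := ev (comp_aff eta alpha) x - ev (comp_aff eta alpha) x'.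
have eta_d t : ev eta (c + t *: d) = ev eta c + t * (eta1 ^+ 2 + eta2 ^+ 2).
  by rewrite !ev_aff2 !mxE /=; ring.
have del0 : 0 < del alpha0.
  have at0 : dot (x - x') (x' - x') = 0 by rewrite subrr -(scale0r x) dotZr mul0r.
  rewrite /del !ev_comp !contractionE !eta_d at0 mulr0 mul0r addr0 addrAC subrr add0r.
  by rewrite !mulr_gt0 // dot_gt0 // subr_eq0.
pose O := ball alpha0 e `&` del @^-1` [set t | del alpha0 / 2 < t].
have cdel : continuous del by apply: sub_cont; exact: ev_comp_continuous.
have oO : open O.
  apply: openI; first exact: ball_open.
  by apply: open_comp; [move=> ? _; exact: cdel|exact: open_gt].
have OD : O `<=` D by rewrite base_HomE => alpha [/he].
have O0 : (0 < nu O)%E.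
  apply: translation_invariant_gt0 => //; exists alpha0; split; first exact: ballxx.
  by rewrite /= ltr_pdivrMr // ltr_pMr // ltr1n.
rewrite mulrC ev_roof_mean // -(meanZ dom_measurable dom_fin); last exact: slope_bmeas.
apply: (@mean_lt _ _ _ _ D dom_measurable dom_gt0 dom_fin _ _ O (del alpha0 / 2)) => //.
- exact/bmeasZ/slope_bmeas.
- exact: comp_eta_bmeas.
- by move=> alpha Da; rewrite mulrC; apply: (slope_le _ QS) => // y; exact: comp_eta_ge0.
- exact: open_borel.
- by rewrite divr_gt0.
move=> alpha Oa; have Da := OD _ Oa; move: Oa => [_]; rewrite /= /del => h.
have g0 y : Q y -> 0 <= ev (comp_aff eta alpha) y by exact: comp_eta_ge0.
have := slope_le_one QS sp g0 Qx' sx'.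
have [m [M [m0 /(_ _ Da)/andP[mt _]]]] := slope_bounds.
have /andP[_ sx] := s01 Qx.
have : ev s x * slope S c s (comp_aff eta alpha) <= slope S c s (comp_aff eta alpha).
  by rewrite ler_piMl // (le_trans (ltW m0) mt).
lra.
Qed.

End Edge.

Lemma slope_inj s s' p p' : edge_fun s p -> edge_fun s' p' ->
  slope_mean s *: s = slope_mean s' *: s' -> s = s'.
Proof.
move=> sp sp' E.
have le u v q q' : edge_fun u q -> edge_fun v q' ->
      slope_mean u *: u = slope_mean v *: v -> slope_mean u <= slope_mean v.
  move=> uq vq' /(congr1 (fun f => ev f (refl q.1))); rewrite !evZ.
  have [[q1 _ _] _ _ -> _] := uq; have [_ _ _ _ v01] := vq'; rewrite mulr1 => ->.
  have /andP[_ v1] : 0 <= ev v (refl q.1) <= 1.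
    by apply: v01; apply: (S_Q QS); exact: S_sym.
  by rewrite ler_piMr // ltW // (slope_mean_gt0 vq').
have tE : slope_mean s = slope_mean s'.
  by apply/eqP; rewrite eq_le (le _ _ _ _ sp sp') // (le _ _ _ _ sp' sp).
move/eqP: E; rewrite -tE -subr_eq0 -scalerBr scaler_eq0 gt_eqF ?(slope_mean_gt0 sp) //=.
by rewrite subr_eq0 => /eqP.
Qed.

Lemma fiber_Hom_convex : convex F.
Proof.
apply: (fiber_convex dom_measurable dom_fin X_bound).
by apply: Hom_convex; exact: polytope_convex.
Qed.

(** The points [slope_mean s *: s] are strictly below [roof_mean] everywhere, while their
reflections meet it at the points where [s] vanishes; so the two families are disjoint. *)
Lemma fiber_vertices (es : seq aff) : uniq es -> es != [::] ->
  (forall s, s \in es -> exists p, edge_fun s p) ->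
  exists vs, [/\ uniq vs, forall x, x \in vs -> vert F x & size vs = (2 + 2 * size es)%N].
Proof.
move=> ues es_n0 esP.
pose A s : aff := slope_mean s *: s.
have lt s x : s \in es -> Q x -> ev (A s) x < ev roof_mean x.
  by move=> /esP[p sp] Qx; rewrite evZ; exact: slope_lt_roof sp _ Qx.
have A0 s : s \in es -> A s != 0.
  move=> /esP[p sp]; have t0 := slope_mean_gt0 sp.
  apply/eqP => /(congr1 (fun u => ev u (refl p.1))); rewrite evZ ev0.
  by have [_ _ _ -> _] := sp; rewrite mulr1 => /eqP; rewrite gt_eqF.
have Ag s : s \in es -> A s != roof_mean.
  by move=> es_s; have := lt s c es_s Qc; apply: contraTneq => ->; rewrite ltxx.
have AB s s' : s \in es -> s' \in es -> A s != roof_mean - A s'.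
  move=> es_s es_s'; have [p [[p1 _ _] sv _ _ _]] := esP _ es_s'.
  have := lt s p.1 es_s (S_Q QS p1); apply: contraTneq => ->.
  by rewrite evB evZ sv mulr0 subr0 ltxx.
have Ainj : {in es &, injective A}.
  by move=> s s' /esP[p sp] /esP[p' sp']; exact: slope_inj sp sp'.
have g0 : roof_mean != 0.
  have [s es_s] : exists s, s \in es.
    by case: es es_n0 {ues esP lt A0 Ag AB Ainj} => // s es' _; exists s; exact: mem_head.
  have [p sp] := esP _ es_s; apply/eqP => g0.
  have := lt s c es_s Qc; rewrite g0 ev0 evZ (edge_fun_center sp) ltNge.
  by rewrite mulr_ge0 ?invr_ge0 // ltW // (slope_mean_gt0 sp).
have AV s : s \in es -> vert F (row_mx base_mean (A s)).
  by move=> /esP[p sp]; exact: vert_slope sp.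
pose ks := 0 :: roof_mean :: map A es ++ map (fun s => roof_mean - A s) es.
exists (map (row_mx base_mean) ks); split.
- rewrite map_inj_uniq => [|u v /eq_row_mx[]//]; rewrite /= inE negb_or mem_cat negb_or.
  rewrite eq_sym g0 mem_cat negb_or cat_uniq !map_inj_in_uniq ?ues //=; last first.
    by move=> s s' es_s es_s' /addrI/oppr_inj; exact: Ainj.
  rewrite andbT -!andbA; apply/and5P; split.
  - by apply/mapP => -[s es_s /eqP]; rewrite eq_sym (negPf (A0 _ es_s)).
  - apply/mapP => -[s es_s /esym/eqP]; rewrite subr_eq0 eq_sym.
    by rewrite (negPf (Ag _ es_s)).
  - by apply/mapP => -[s es_s /eqP]; rewrite eq_sym (negPf (Ag _ es_s)).
  - apply/mapP => -[s es_s /eqP]; rewrite -subr_eq0 subKr.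
    by rewrite (negPf (A0 _ es_s)).
  - apply/hasPn => _ /mapP[s' es_s' ->]; apply/mapP => -[s es_s /eqP].
    by rewrite eq_sym (negPf (AB _ _ es_s es_s')).
- move=> _ /mapP[k kks ->]; move: kks.
  rewrite !inE mem_cat => /or3P[/eqP ->|/eqP ->|/orP[]/mapP[s es_s ->]].
  + exact: vert_zero.
  + by rewrite -[roof_mean]subr0; apply: vert_refl; exact: vert_zero.
  + exact: AV.
  + by apply: vert_refl; exact: AV.
- by rewrite size_map /= size_cat !size_map mul2n addnn.
Qed.

End HomFiber.

(** * The fiber of P over Q *)

Section BaseFiber.
Context {R : realType}.
Local Notation R2 := 'rV[R]_2.
Local Notation R3 := 'rV[R]_(2 + 1).
Local Notation aff := 'cV[R]_(1 + 2).
Context (Q : set R2) (P : set R3) (eta : aff) (c : R2) (r : R).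
Hypothesis r_gt0 : 0 < r.
Hypothesis ball_Q : ball c r `<=` Q.
Hypothesis Q_compact : compact Q.
Hypothesis P_compact : compact P.
Hypothesis eta_gt0 : forall x, Q x -> 0 < ev eta x.
Hypothesis PE : forall x t, P (pt x t) <-> Q x /\ 0 <= t <= ev eta x.
Context (mu : {measure set (borel R2) -> \bar R}).
Hypothesis mu_inv : translation_invariant setT mu.
Local Notation proj := (@lsubmx R 1 2 1).
Local Notation D := (proj @` P : set (borel R2)).
Local Notation mean := (mean mu D).
Local Notation vmean := (vmean mu proj P).

Lemma base_E : D = Q.
Proof.
apply/seteqP; split => [_ [z Pz <-]|x Qx].
  by move: Pz; rewrite (pt_proj z) => /PE[]; rewrite row_mxKl.
exists (pt x 0); last exact: row_mxKl.
by apply/PE; rewrite lexx ltW // eta_gt0.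
Qed.

Lemma base_mD : measurable D.
Proof. by rewrite base_E; apply: closed_borel; exact: compact_mx_closed. Qed.

Lemma base_D_fin : (mu D < +oo)%E.
Proof. by have [_ _ h _] := mu_inv; rewrite base_E; exact: h. Qed.

Lemma base_D_gt0 : (0 < mu D)%E.
Proof.
rewrite base_E; apply: (@lt_le_trans _ _ (mu (ball c r))).
  apply: translation_invariant_gt0 => //; first exact: ball_open.
  by exists c; exact: ballxx.
apply: le_measure => //; rewrite inE; first by apply: open_borel; exact: ball_open.
by rewrite -base_E; exact: base_mD.
Qed.

Let P_bound := compact_mx_bounded P_compact.

Definition centroid : R2 := \matrix_(i, j) mean (fun y : borel R2 => (y : R2) i j).
Definition mean_height : R := mean (fun y : borel R2 => ev eta (y : R2)).

Lemma eta_bmeas : bmeas D (fun y : borel R2 => ev eta (y : R2)).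
Proof.
have [b Pb] := P_bound; split.
  by apply: measurable_funTS; apply: continuous_borel; exact: ev_continuous.
exists b => y; rewrite base_E => Qy.
have : P (pt y (ev eta y)) by apply/PE; rewrite lexx ltW // eta_gt0.
by move=> /Pb/(_ 0 (rshift 2 0)); rewrite row_mxEr mxE eqxx.
Qed.

(** The graph of [k * eta] is a section. *)
Lemma graph_vmean (k : R) : 0 <= k <= 1 ->
  fiber mu proj P (pt centroid (k * mean_height)).
Proof.
move=> /andP[k0 k1].
have sg : borel_sections proj P (fun y => pt y (k * ev eta y)).
  apply: continuous_section.
  - apply: mx_continuous => i j; case: (split_ordP j) => l ->.
      rewrite (_ : (fun y : R2 => _) = fun y : R2 => y i l); first exact: coord_continuous.
      by apply/funext => y; rewrite row_mxEl.
    rewrite (_ : (fun y : R2 => _) = fun y : R2 => k * ev eta y).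
      by apply: mul_cont; [exact: cst_cont|exact: ev_continuous].
    by apply/funext => y; rewrite row_mxEr !ord1 mxE eqxx.
  - move=> y; rewrite base_E => Qy; apply/PE; split => //.
    have e0 := ltW (eta_gt0 Qy); rewrite mulr_ge0 //=; exact: ler_piMl.
  - by move=> y _; exact: row_mxKl.
apply/fiberP; eexists; first exact: sg.
apply/rowP => j; rewrite [RHS]mxE /pt; case: (split_ordP j) => l ->.
  by rewrite row_mxEl [LHS]mxE; apply: eq_mean => y _; rewrite row_mxEl.
rewrite row_mxEr !ord1 [LHS]mxE eqxx mulr1n -(meanZ base_mD base_D_fin); last exact: eta_bmeas.
by apply: eq_mean => y _; rewrite row_mxEr mxE eqxx.
Qed.

(** On a ball around [c] the height exceeds half of its value at [c]. *)
Lemma mean_height_gt0 : 0 < mean_height.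
Proof.
have Qcl := compact_mx_closed Q_compact.
have cc : Q c by apply: ball_Q; exact: ballxx.
rewrite -(mean_cst base_mD base_D_gt0 base_D_fin 0).
pose O := ball c r `&` ev eta @^-1` [set t | ev eta c / 2 < t].
have oO : open O.
  apply: openI; first exact: ball_open.
  by apply: open_comp; [move=> ? _; exact: ev_continuous|exact: open_gt].
have OD : O `<=` D by rewrite base_E => y [/ball_Q].
apply: (@mean_lt _ _ _ _ D base_mD base_D_gt0 base_D_fin _ _ O (ev eta c / 2)).
- exact: bmeas_cst.
- exact: eta_bmeas.
- by move=> y; rewrite base_E => /eta_gt0/ltW.
- exact: open_borel.
- exact: OD.
- apply: translation_invariant_gt0 => //; exists c; split; first exact: ballxx.
  by rewrite /= ltr_pdivrMr // ltr_pMr ?ltr1n // eta_gt0.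
- by rewrite divr_gt0 // eta_gt0.
- by move=> y [_ /= /ltW]; rewrite add0r.
Qed.

(** The fiber of the projection of [P] is the vertical segment above the centroid of
[Q] whose length is the mean height of [P]. *)
Lemma fiber_baseE z : fiber mu proj P z <->
  proj z = centroid /\ 0 <= height z <= mean_height.
Proof.
split=> [/fiberP[gam sg ->]|[zc /andP[z0 z1]]]; last first.
  rewrite (pt_proj z) /proj_base zc -[height z](divfK (lt0r_neq0 mean_height_gt0)).
  apply: graph_vmean; rewrite divr_ge0 // ?(ltW mean_height_gt0) //=.
  by rewrite ler_pdivrMr ?mul1r // mean_height_gt0.
have [_ gX gE] := sg; split.
  by apply/matrixP => i j; rewrite !mxE; apply: eq_mean => y Dy; rewrite -{2}(gE _ Dy) mxE.
have [l lE] := @height_scalar R.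
have Pg y : D y -> 0 <= height (gam y) <= ev eta y.
  move=> Dy; have : P (gam y) by apply: gX; exists y.
  by rewrite {1}(pt_proj (gam y)) /proj_base gE // => /PE[].
rewrite -lE (scalar_vmean base_mD base_D_gt0 base_D_fin P_bound) //.
rewrite -(mean_cst base_mD base_D_gt0 base_D_fin 0).
have lb := section_scalar_bmeas P_bound l sg.
apply/andP; split; apply: (mean_le base_mD base_D_gt0 base_D_fin) => //.
- exact: bmeas_cst.
- by move=> y /Pg/andP[+ _]; rewrite lE.
- exact: eta_bmeas.
- by move=> y /Pg/andP[_]; rewrite lE.
Qed.

End BaseFiber.

(** * Counting vertices *)

Section Counting.
Context {R : realType}.

Lemma nvert_le (V : lmodType R) (K : set V) (ws : seq V) :
  (forall x, vert K x -> x \in ws) -> (nvert K <= (size ws)%:R%:E)%E.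
Proof.
move=> Kws; have fK : finite_set (vert K).
  by apply: (sub_finite_set (B := [set` ws])) => //; exact: finite_seq.
rewrite /nvert /counting asboolT // lee_fin ler_nat.
apply: uniq_leq_size; first exact: finmap.fset_uniq.
by move=> x; rewrite in_fset_set // inE; exact: Kws.
Qed.

Lemma nvert_ge (V : lmodType R) (K : set V) (vs : seq V) : uniq vs ->
  (forall x, x \in vs -> vert K x) -> ((size vs)%:R%:E <= nvert K)%E.
Proof.
move=> uvs Kvs; rewrite /nvert /counting; case: asboolP => fK; last exact: leey.
rewrite lee_fin ler_nat; apply: uniq_leq_size => // x /Kvs Kx.
by rewrite in_fset_set // inE.
Qed.

(** Convexity of [K] makes the midpoint of the preimages available in [K]. *)
Lemma extreme_image (V U : lmodType R) (K : set V) (L : set U) (psi : V -> U) x :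
  convex K -> affine_on K psi -> set_bij K L psi -> extreme K x -> extreme L (psi x).
Proof.
move=> cK apsi [Khom Kinj Ksurj] [Kx xe].
split; first exact: Khom.
move=> _ _ /Ksurj[y Ky <-] /Ksurj[z Kz <-] E.
have h : 1 - 2^-1 = 2^-1 :> R by lra.
have h01 : 0 <= (2^-1 : R) <= 1 by rewrite invr_ge0 ler0n invf_le1 ?ltr0n // ler1n.
have Km := cK _ _ _ Ky Kz h01.
have := apsi _ _ _ Ky Kz h01; rewrite h -E => /Kinj xE; rewrite h in Km.
by rewrite (xe _ _ Ky Kz) // -xE // inE.
Qed.

End Counting.

(** * Affine maps from the polygon to a segment *)

Section HomSegment.
Context {R : realType}.
Local Notation R2 := 'rV[R]_2.
Local Notation R3 := 'rV[R]_(2 + 1).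
Local Notation aff := 'cV[R]_(1 + 2).
Context (Q : set R2) (S : seq R2) (c : R2) (r : R) (sigma : set R3) (c1 : R2) (H : R).
Hypothesis QS : Q = conv_hull [set` S].
Hypothesis S_sym : forall x, x \in S -> c *+ 2 - x \in S.
Hypothesis r_gt0 : 0 < r.
Hypothesis ball_Q : ball c r `<=` Q.
Hypothesis H_gt0 : 0 < H.
Hypothesis sigmaE : forall z, sigma z <-> lsubmx z = c1 /\ 0 <= height z <= H.

Lemma Hom_segmentE (M : 'M[R]_(1 + 2, 2 + 1)) : Hom_set Q sigma M <->
  lsubmx M = col_mx c1 0 /\ forall x, Q x -> 0 <= ev (rsubmx M) x <= H.
Proof.
have E x : sigma (aff_of M x) <-> aff_of (lsubmx M) x = c1 /\ 0 <= ev (rsubmx M) x <= H.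
  by rewrite sigmaE aff_of_row row_mxKl /height row_mxKr.
have cE x : aff_of (col_mx c1 (0 : 'M[R]_(2, 2))) x = c1.
  by rewrite aff_ofE col_mxKu col_mxKd mulmx0 addr0.
split=> [h|[h1 h2] _ [x Qx <-]]; last by apply/E; split; [rewrite h1 cE|exact: h2].
have {}h x : Q x -> sigma (aff_of M x) by move=> Qx; apply: h; exists x.
split=> [|x /h/E[]//]; apply: (aff_of_inj (Q_aff_hull r_gt0 ball_Q)) => x /h/E[-> _].
by rewrite cE.
Qed.

Lemma extreme_Hom_segment (es : seq aff) M :
  (forall s p, edge_fun Q S c s p -> s \in es) -> extreme (Hom_set Q sigma) M ->
  M \in [seq row_mx (col_mx c1 0) (H *: s) | s <- const_aff 0 :: const_aff 1 :: es].
Proof.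
move=> es_all [LM eM]; have [Ml Mr] := (Hom_segmentE M).1 LM.
have Hn : H != 0 by rewrite gt_eqF.
have up (s : aff) : unit_fun Q s -> Hom_set Q sigma (row_mx (col_mx c1 0) (H *: s)).
  move=> s01; apply/Hom_segmentE; rewrite row_mxKl row_mxKr; split => // x /s01 /andP[s0 s1].
  by rewrite evZ mulr_ge0 ?(ltW H_gt0) //= ler_piMr // ltW.
pose s := H^-1 *: rsubmx M.
have ME : M = row_mx (col_mx c1 0) (H *: s).
  by rewrite /s scalerA divff // scale1r -Ml hsubmxK.
apply/mapP; exists s => //.
have : extreme (unit_fun Q) s.
  split=> [x /Mr /andP[m0 m1]|y z y01 z01 E].
    by rewrite evZ mulr_ge0 ?invr_ge0 ?(ltW H_gt0) //= mulrC ler_pdivrMr // mul1r.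
  have := eM _ _ (up _ y01) (up _ z01); rewrite ME => h.
  have /h/eq_row_mx[_ /(scalerI Hn)//] : row_mx (col_mx c1 0) (H *: s) =
      2^-1 *: row_mx (col_mx c1 0) (H *: y) + 2^-1 *: row_mx (col_mx c1 0) (H *: z).
  rewrite !scale_row_mx add_row_mx E; congr row_mx; last by rewrite scalerDr !scalerA !(mulrC H).
  by rewrite -scalerDl -[LHS]scale1r; congr (_ *: _); field.
case/(extreme_unit_fun QS S_sym r_gt0 ball_Q) => [->|->|[p /es_all sp]].
- by rewrite mem_head.
- by rewrite !inE eqxx orbT.
- by rewrite !inE sp !orbT.
Qed.

End HomSegment.

(** * Comparison of the two constructions *)

Theorem theorem4p1 (R : realType)
    (Q : set 'rV[R]_2) (P Q' : set 'rV[R]_(2 + 1)) (eps : R)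
    (* Q is a centrally symmetric convex polygon *)
    (Q_polytope : polytope Q) (Q_dim2 : aff_hull Q = setT)
    (Q_sym : centrally_symmetric Q)
    (* P is a slant-truncated right prism over Q, Q' is opposite to Q *)
    (P_polytope : polytope P)
    (eps_gt0 : 0 < eps)
    (P_right : cyl (rel_boundary Q) `[0, eps] `<=` rel_boundary P)
    (P_prism : exists Phi : set 'rV[R]_(2 + 1) -> set 'rV[R]_(2 + 1),
      [/\ face_iso (cyl Q `[0, 1]) P Phi,
          Phi (cyl Q [set 0]) = cyl Q [set 0] &
          Phi (cyl Q [set 1]) = Q'])
    (P_slant : ~ parallel Q' (cyl Q [set 0]))
    (* the measures used to define the two fibers *)
    (mu : {measure set (borel 'rV[R]_2) -> \bar R})
    (mu_inv : translation_invariant (aff_hull (proj_base @` P)) mu)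
    (nu : {measure set (borel 'M[R]_(1 + 2, 2)) -> \bar R})
    (nu_inv :
       translation_invariant (aff_hull (Hom_map proj_base @` Hom_set Q P)) nu) :
  (nvert (Hom_set Q (fiber mu proj_base P)) + 2%:E
     <= nvert (fiber nu (Hom_map proj_base) (Hom_set Q P)))%E /\
  ~ aff_isomorphic (fiber nu (Hom_map proj_base) (Hom_set Q P))
                   (Hom_set Q (fiber mu proj_base P)).
Proof.
have [s QE] := Q_polytope; have [c cQ] := Q_sym; have [Phi [isoPhi Phi0 Phi1]] := P_prism.
have Qcvx := polytope_convex Q_polytope.
have [r r0 rQ] := symmetric_ball Qcvx cQ Q_dim2.
(* Enlarge the list of generators to one that is closed under the symmetry. *)
pose S := s ++ [seq c *+ 2 - x | x <- s].
have refl2 x : c *+ 2 - (c *+ 2 - x) = x by rewrite subKr.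
have S_sym x : x \in S -> c *+ 2 - x \in S.
  rewrite !mem_cat => /orP[xs|/mapP[y ys ->]]; last by rewrite refl2 ys.
  by apply/orP; right; apply/mapP; exists x.
have QS : Q = conv_hull [set` S].
  apply/seteqP; split.
    rewrite {1}QE; apply: conv_hull_sub => x /= xs; apply: sub_conv_hull.
    by rewrite /= mem_cat xs.
  apply: conv_hull_min => // x; rewrite /= mem_cat => /orP[xs|/mapP[y ys ->]].
    by rewrite QE; exact: sub_conv_hull.
  by apply: cQ; rewrite QE; exact: sub_conv_hull.
have [eta [eta_gt0 PE Q'E]] := truncated_prism Q_polytope r0 rQ P_polytope eps_gt0 P_right
  (face_P_base isoPhi Phi0) (face_P_top isoPhi Phi1) (base_top_disjoint isoPhi Phi0 Phi1)
  (vert_base_top isoPhi Phi0 Phi1).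
have [a [b [d etaE]]] := aff2_coord eta.
have slant : 0 < b ^+ 2 + d ^+ 2.
  rewrite lt_neqAle addr_ge0 ?sqr_ge0 // andbT eq_sym paddr_eq0 ?sqr_ge0 // !sqrf_eq0.
  apply/negP => /andP[/eqP b0 /eqP d0]; apply: P_slant; exists (pt 0 (- a)).
  rewrite -aff_hull_translate; congr aff_hull.
  have move_pt x : pt x a + pt 0 (- a) = pt x 0.
    by rewrite -[pt x a]scale1r -[pt 0 _]scale1r pt_comb scaler0 addr0 scale1r !mul1r subrr.
  have etac x : ev eta x = a by rewrite etaE b0 d0 ev_aff2 !mul0r !addr0.
  rewrite Q'E; apply/seteqP; split => [z /cyl1E[Qz z0]|_ [_ [x Qx <-] <-]].
    exists (pt (proj_base z) a); first by exists (proj_base z) => //; rewrite etac.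
    by rewrite move_pt -z0 -pt_proj.
  by rewrite etac move_pt; apply/cyl1E; rewrite proj_pt height_pt.
rewrite etaE in eta_gt0 PE.
(* On matrices, composition with the projection of [P] drops the last column. *)
have projE : @Hom_map R 2 _ _ proj_base = @lsubmx R (1 + 2) 2 1.
  by apply/funext => M; exact: Hom_map_proj.
have muT : translation_invariant setT mu.
  move: mu_inv; rewrite (_ : proj_base @` P = Q) ?Q_dim2 //.
  exact: (base_E eta_gt0 PE).
have nuT : translation_invariant setT nu.
  move: nu_inv; rewrite projE.
  have -> : @lsubmx R (1 + 2) 2 1 @` Hom_set Q P = Hom_set Q Q := base_HomE eta_gt0 PE.
  have [k _ [e e0 he]] := contraction_interior QS r0 rQ 0 0 0.
  by rewrite (ball_aff_hull e0 he).
rewrite projE.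
have Q_cpt := polytope_compact Q_polytope; have P_cpt := polytope_compact P_polytope.
pose H := mean_height P (aff2 a b d) mu.
have H0 : 0 < H := mean_height_gt0 r0 rQ Q_cpt P_cpt eta_gt0 PE muT.
have sigmaE := fiber_baseE r0 rQ Q_cpt P_cpt eta_gt0 PE muT.
have [es [ues esE]] := edge_fun_seq Q S c.
have [s0 [p0 sp0]] := edge_fun_exists QS S_sym r0 rQ.
have es0 : s0 \in es by apply/esE; exists p0.
(* If [s0] is an edge function, so is [1 - s0]. *)
have es2 : (2 <= size es)%N.
  apply: (@uniq_leq_size _ [:: s0; const_aff 1 - s0]).
    rewrite /= inE andbT; apply/eqP => /(congr1 (fun u => ev u p0.1)).
    rewrite evB ev_const_aff; have [_ -> _ _ _] := sp0.
    by move/eqP; rewrite subr0 eq_sym oner_eq0.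
  move=> x; rewrite !inE => /orP[/eqP ->//|/eqP ->]; apply/esE.
  by exists (c *+ 2 - p0.1, c *+ 2 - p0.2); exact: edge_fun_compl.
have [vs [uvs vsF size_vs]] := fiber_vertices QS S_sym r0 rQ P_polytope eta_gt0 PE slant nuT ues
  (ltac:(by case: es es0 {ues esE es2}) : es != [::]) (fun t h => (esE t).1 h).
set F := fiber nu _ _ in vsF *.
set L := Hom_set Q (fiber mu _ _).
pose ws := [seq row_mx (col_mx (centroid P mu) 0) (H *: t) | t <- const_aff 0 :: const_aff 1 :: es].
have Lws M : extreme L M -> M \in ws.
  apply: (extreme_Hom_segment QS S_sym r0 rQ H0 sigmaE) => t p tp.
  by apply/esE; exists p.
have size_ws : size ws = (2 + size es)%N by rewrite size_map.
split.
  apply: (le_trans (y := ((size ws)%:R%:E + 2%:E)%E)).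
    by apply: leeD2r; apply: nvert_le => M /vert_extreme/Lws.
  apply: le_trans (nvert_ge uvs vsF).
  by rewrite -EFinD lee_fin -natrD ler_nat size_ws size_vs; lia.
move=> [psi [apsi bpsi]].
have FC : convex F := fiber_Hom_convex QS r0 rQ P_polytope eta_gt0 PE nuT.
have : (size (map psi vs) <= size ws)%N.
  apply: uniq_leq_size.
    rewrite map_inj_in_uniq // => x y /vsF/vert_sub Fx /vsF/vert_sub Fy.
    by have [_ + _] := bpsi; apply; rewrite inE.
  move=> _ /mapP[x /vsF/vert_extreme Fx ->]; apply: Lws.
  exact: extreme_image FC apsi bpsi Fx.
by rewrite size_map size_vs size_ws; lia.
Qed.
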